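(* Let $H$ be a separable complex Hilbert space and let $\mathbf A=(T_{kj})_{k,j\in\mathbb N}$ be a Toeplitz matrix with entries in $\mathcal B(H)$ such that $\mathbf A\in\mathcal M_r(\ell^2(H))$. Then there exists $\mu\in M_{SOT}(\mathbb T,\mathcal B(H))$ such that $T_{kj}=\hat\mu(j-k)$ for all $k,j\in\mathbb N$. Moreover $\|\mu\|_{SOT}\le\|\mathbf A\|_{\mathcal M_r(\ell^2(H))}$.
   Context: $\mathbb N=\{1,2,\dots\}$, $\mathbb T=\{z\in\mathbb C:|z|=1\}$ is identified with $[0,2\pi)$ via $t\mapsto e^{it}$, $\varphi_k(t)=e^{ikt}$, and $\mathfrak B(\mathbb T)$ is the Borel $\sigma$-algebra. Matrices: $\mathcal B(H)$ is the space of bounded operators on $H$. $\ell^2(H)$ is the Hilbert space of square-summable sequences $\mathbf x=(x_j)_{j\in\mathbb N}$ in $H$, $c_{00}(H)$ its subspace of finitely supported sequences. For a matrix $\mathbf A=(T_{kj})$ with entries in $\mathcal B(H)$ and $\mathbf x\in c_{00}(H)$, $\mathbf A(\mathbf x)=\big(\sum_jT_{kj}(x_j)\big)_k$; $\mathbf A\in\mathcal B(\ell^2(H))$ means that there is $C\ge0$ with $\|\mathbf A(\mathbf x)\|_{\ell^2(H)}\le C\|\mathbf x\|_{\ell^2(H)}$ for all $\mathbf x\in c_{00}(H)$, and $\|\mathbf A\|_{\mathcal B(\ell^2(H))}$ is the least such $C$. The Schur product of $\mathbf B=(S_{kj})$ and $\mathbf A=(T_{kj})$ is $\mathbf B*\mathbf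 A=(S_{kj}T_{kj})$ (entrywise composition). $\mathbf A\in\mathcal M_r(\ell^2(H))$ (right Schur multiplier) if $\mathbf B*\mathbf A\in\mathcal B(\ell^2(H))$ for every $\mathbf B\in\mathcal B(\ell^2(H))$, and $\|\mathbf A\|_{\mathcal M_r(\ell^2(H))}=\inf\{C\ge0:\|\mathbf B*\mathbf A\|_{\mathcal B(\ell^2(H))}\le C\|\mathbf B\|_{\mathcal B(\ell^2(H))}\ \forall\,\mathbf B\in\mathcal B(\ell^2(H))\}$. A matrix $(T_{kj})$ is Toeplitz if $T_{kj}$ depends only on $k-j$. Measures: for a Banach space $E$, $\mathfrak M(\mathbb T,E)$ is the space of regular ($E$-valued, countably additive) Borel vector measures $\mu:\mathfrak B(\mathbb T)\to E$, where regular means: for every $\varepsilon>0$ and $B\in\mathfrak B(\mathbb T)$ there are a compact $K$ and an open $O$ with $K\subset B\subset O$ and $\|\mu\|(O\setminus K)<\varepsilon$; here $\|\mu\|(B)=\sup_{\|e^*\|=1}|e^*\circ\mu|(B)$ is the semivariation. $M(\mathbb T,E)$ is the subspace of those $\mu$ of bounded variation, with $|\mu|=\sup\{\sum_{A\in\pi}\|\mu(A)\|:\pi\text{ a finite Borel partition of }\mathbb T\}$. For $k\in\mathbb Z$, $\hat\mu(k)=\int\varphi_k\,d\mu\in E$. For $\mu\in\mathfrak M(\mathbb T,\mathcal B(H))$ and $x\in H$, $\mu_x(A)=\mu(A)(x)$. $M_{SOT}(\mathbb T,\mathcal B(H))$ is the space of $\mu\in\mathfrak M(\mathbb T,\mathcal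 B(H))$ such that $\mu_x\in M(\mathbb T,H)$ for every $x\in H$, with $\|\mu\|_{SOT}=\sup\{|\mu_x|:x\in H,\|x\|=1\}$. *)

(* Defs.v *)
From HB Require Import structures.
From mathcomp Require Import all_boot all_order all_algebra.
From mathcomp.real_closed Require Import complex.
From mathcomp Require Import all_classical all_reals all_analysis.

Set Implicit Arguments.
Unset Strict Implicit.
Unset Printing Implicit Defensive.

Import Order.TTheory GRing.Theory Num.Theory.
Import numFieldNormedType.Exports.

Local Open Scope classical_set_scope.
Local Open Scope ring_scope.
Local Open Scope complex_scope.

(* Naming the field structure of R[i] keeps reverse coercions out of the terms
   and gives access to the norm topology of a numClosedFieldType. *)
Definition C (R : realType) : numClosedFieldType :=
  [the numClosedFieldType of R[i]].

Section RtoCTheory.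
Context {R : realType}.

Definition RtoC (r : R) : C R := r%:C.

Lemma ler_RtoC (r s : R) : (RtoC r <= RtoC s) = (r <= s).
Proof. exact: lecR. Qed.

Lemma RtoC_inj : injective RtoC.
Proof. exact: complexI. Qed.

Lemma RtoCD (r s : R) : RtoC (r + s) = RtoC r + RtoC s.
Proof. exact: (rmorphD (real_complex R)). Qed.

Lemma RtoCM (r s : R) : RtoC (r * s) = RtoC r * RtoC s.
Proof. exact: (rmorphM (real_complex R)). Qed.

Lemma RtoC0 : RtoC 0 = 0.
Proof. by []. Qed.

Lemma RtoCV (r : R) : RtoC r^-1 = (RtoC r)^-1.
Proof. exact: (fmorphV (real_complex R)). Qed.

End RtoCTheory.

(* Norms on complex normed modules take their values in C R; rnorm is the same
   norm read as an element of R. *)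
Definition rnorm (R : realType) (V : normedModType (C R)) (x : V) : R :=
  complex.Re `|x|.

Section RnormTheory.
Context {R : realType} {V : normedModType (C R)}.
Implicit Types x y : V.

Lemma rnormE x : RtoC (rnorm x) = `|x|.
Proof. exact/RRe_real/(@normr_real (C R) V). Qed.

Lemma rnorm_ge0 x : 0 <= rnorm x.
Proof. by rewrite -ler_RtoC rnormE normr_ge0. Qed.

Lemma rnorm0 : rnorm (0 : V) = 0.
Proof. by rewrite /rnorm normr0. Qed.

Lemma rnorm_eq0 x : rnorm x = 0 -> x = 0.
Proof. by move=> x0; apply/normr0_eq0; rewrite -rnormE x0. Qed.

Lemma rnormD x y : rnorm (x + y) <= rnorm x + rnorm y.
Proof. by rewrite -ler_RtoC RtoCD !rnormE ler_normD. Qed.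

End RnormTheory.

Lemma rnormZ (R : realType) (V : normedModType (C R)) a (x : V) :
  rnorm (a *: x) = rnorm a * rnorm x.
Proof. by apply/RtoC_inj; rewrite RtoCM; rewrite !rnormE normrZ. Qed.

Definition bounded_linear (R : realType) (E F : normedModType (C R))
    (f : E -> F) : Prop :=
  linear f /\ exists M : R, forall x, rnorm (f x) <= M * rnorm x.

Definition bounded_linear_pred (R : realType) (E F : normedModType (C R)) :
  {pred (E -> F)} := mem [set f : E -> F | bounded_linear f].

Record bop (R : realType) (E F : normedModType (C R)) := Bop {
  bop_fun :> E -> F;
  bop_funP : bop_fun \in @bounded_linear_pred R E F
}.

HB.instance Definition _ (R : realType) (E F : normedModType (C R)) :=
  [isSub of bop E F for @bop_fun R E F].
HB.instance Definition _ (R : realType) (E F : normedModType (C R)) :=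
  [Choice of bop E F by <:].

Lemma bounded_linear_closed (R : realType) (E F : normedModType (C R)) :
  subsemimod_closed (@bounded_linear_pred R E F).
Proof.
split; [split=> [|f g /set_mem[fl [M fM]] /set_mem[gl [N gN]]]|
  move=> a f /set_mem[fl [M fM]]]; apply/mem_set; split.
- by move=> a x y; rewrite -[LHS]/(0 : F) -[RHS]/(a *: (0 : F) + 0) scaler0 addr0.
- by exists 0 => x; rewrite -[X in rnorm X]/(0 : F) rnorm0 mul0r.
- move=> a x y; rewrite -[LHS]/(f (a *: x + y) + g (a *: x + y)).
  by rewrite fl gl addrACA -scalerDr.
- exists (M + N) => x; rewrite mulrDl.
  by rewrite (le_trans (rnormD (f x) (g x)))// lerD.
- move=> b x y; rewrite -[LHS]/(a *: f (b *: x + y)).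
  by rewrite fl scalerDr !scalerA mulrC -scalerA.
- exists (rnorm a * M) => x; rewrite -[X in rnorm X]/(a *: f x) rnormZ -mulrA.
  by rewrite ler_wpM2l ?rnorm_ge0.
Qed.

HB.instance Definition _ (R : realType) (E F : normedModType (C R)) :=
  GRing.SubChoice_isSubLmodule.Build (C R) (E -> F) (@bounded_linear_pred R E F)
    (bop E F) (@bounded_linear_closed R E F).

Section BopNorm.
Context {R : realType} {E F : normedModType (C R)}.
Implicit Types f g : bop E F.

Definition opnorm f : R :=
  sup [set rnorm (f x) | x in [set x : E | rnorm x <= 1]].

Lemma bop_bounded_linear f : bounded_linear f.
Proof. exact: set_mem (bop_funP f). Qed.

HB.instance Definition _ f :=
  GRing.isLinear.Build (C R) E F _ (bop_fun f) (bop_bounded_linear f).1.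

Lemma opnorm_has_sup f :
  has_sup [set rnorm (f x) | x in [set x : E | rnorm x <= 1]].
Proof.
split; first by exists (rnorm (f 0)); exists 0 => //=; rewrite rnorm0.
have [_ [M fM]] := bop_bounded_linear f.
exists `|M| => _ [x /= x1 <-]; apply: (le_trans (fM x)).
apply: (@le_trans _ _ (`|M| * rnorm x)).
  by rewrite ler_wpM2r ?rnorm_ge0 ?ler_norm.
by rewrite ler_piMr.
Qed.

Lemma opnorm_ub f x : rnorm x <= 1 -> rnorm (f x) <= opnorm f.
Proof.
move=> x1; apply: sup_upper_bound; first exact: opnorm_has_sup.
by exists x.
Qed.

Lemma opnorm_le f (c : R) :
  (forall x, rnorm x <= 1 -> rnorm (f x) <= c) -> opnorm f <= c.
Proof.
move=> fc; apply: ge_sup; first exact: (opnorm_has_sup f).1.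
by move=> _ [x /= x1 <-]; exact: fc.
Qed.

Lemma opnorm_ge0 f : 0 <= opnorm f.
Proof.
apply: le_trans (opnorm_ub f (x := 0) _); first exact: rnorm_ge0.
by rewrite rnorm0.
Qed.

Lemma opnormP f x : rnorm (f x) <= opnorm f * rnorm x.
Proof.
have [x0|x0] := eqVneq (rnorm x) 0.
  by rewrite (rnorm_eq0 x0) linear0 !rnorm0 mulr0.
have xp : 0 < rnorm x by rewrite lt_neqAle eq_sym x0 rnorm_ge0.
have n1 : rnorm (RtoC (rnorm x)^-1) = (rnorm x)^-1.
  by apply/RtoC_inj; rewrite rnormE ger0_norm// (ler_RtoC 0) invr_ge0 ltW.
have := opnorm_ub f (x := RtoC (rnorm x)^-1 *: x).
rewrite linearZ /= !rnormZ n1 mulVf// => /(_ (lexx _)).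
by rewrite ler_pdivrMl// mulrC.
Qed.

Let norm f : C R := RtoC (opnorm f).

Let ler_normD f g : norm (f + g) <= norm f + norm g.
Proof.
rewrite /norm -RtoCD ler_RtoC; apply: opnorm_le => x x1.
rewrite [bop_fun _ x](_ : _ = f x + g x); last by [].
by rewrite (le_trans (rnormD _ _))// lerD ?opnorm_ub.
Qed.

Let normrZ a f : norm (a *: f) = `|a| * norm f.
Proof.
have le b g : opnorm (b *: g) <= rnorm b * opnorm g.
  apply: opnorm_le => x x1; rewrite [bop_fun _ x](_ : _ = b *: g x); last by [].
  by rewrite rnormZ ler_wpM2l ?rnorm_ge0 ?opnorm_ub.
rewrite /norm -[`|a|]rnormE -RtoCM; congr RtoC.
apply/eqP; rewrite eq_le le /=.
have [->|a0] := eqVneq a 0; first by rewrite rnorm0 mul0r opnorm_ge0.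
have ap : 0 < rnorm a.
  rewrite lt_neqAle rnorm_ge0 andbT eq_sym; apply/eqP => /rnorm_eq0 a00.
  by rewrite a00 eqxx in a0.
have n1 : rnorm (a^-1) = (rnorm a)^-1.
  by apply/RtoC_inj; rewrite RtoCV !rnormE normfV.
rewrite -ler_pdivlMl// -n1; apply: le_trans (le a^-1 (a *: f)).
by rewrite scalerA mulVf// scale1r.
Qed.

Let normr0_eq0 f : norm f = 0 -> f = 0.
Proof.
move=> /RtoC_inj f0; apply/val_inj/funext => x /=.
apply/rnorm_eq0/le_anti; rewrite rnorm_ge0 andbT.
by have := opnormP f x; rewrite f0 mul0r.
Qed.

HB.instance Definition _ :=
  @Lmodule_isNormed.Build (C R) (bop E F) norm ler_normD normrZ normr0_eq0.

Lemma bop_normE f : rnorm f = opnorm f.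
Proof. by []. Qed.

End BopNorm.

Lemma bop_comp_subproof (R : realType) (E F G : normedModType (C R))
  (g : bop F G) (f : bop E F) : g \o f \in @bounded_linear_pred R E G.
Proof.
apply/mem_set; split=> [a x y|]; first by rewrite /= !linearP.
exists (opnorm g * opnorm f) => x /=; apply: (le_trans (opnormP _ _)).
by rewrite -mulrA ler_wpM2l ?opnorm_ge0 ?opnormP.
Qed.

Definition bop_comp (R : realType) (E F G : normedModType (C R))
  (g : bop F G) (f : bop E F) : bop E G := Bop (bop_comp_subproof g f).

(* Rows and columns are indexed from 0 instead of 1: this shifts k and j
   together, so the differences k - j are unaffected. *)
Definition op_matrix (R : realType) (H : normedModType (C R)) :=
  nat -> nat -> bop H H.

Section OperatorMatrices.
Context {R : realType} {H : normedModType (C R)}.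
Implicit Types (x : nat -> H) (A B : op_matrix H).

Definition l2norm x : \bar R :=
  sqrte (\sum_(0 <= j <oo) (rnorm (x j) ^+ 2)%:E)%E.

Definition c00 : set (nat -> H) := [set x | finite_set [set j | x j != 0]].

Definition mxapply A x : nat -> H :=
  fun k => \sum_(j \in [set: nat]) A k j (x j).

Definition l2bound A (M : R) : Prop :=
  0 <= M /\ forall x, c00 x -> (l2norm (mxapply A x) <= M%:E * l2norm x)%E.

Definition l2bounded A : Prop := exists M, l2bound A M.

Definition Bl2norm A : \bar R := ereal_inf (EFin @` l2bound A).

Definition schur_prod B A : op_matrix H := fun k j => bop_comp (B k j) (A k j).

Definition right_multiplier A : Prop :=
  forall B, l2bounded B -> l2bounded (schur_prod B A).

Definition right_multiplier_norm A : \bar R :=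
  ereal_inf (EFin @` [set M : R | 0 <= M /\ forall B, l2bounded B ->
    (Bl2norm (schur_prod B A) <= M%:E * Bl2norm B)%E]).

Definition toeplitz A : Prop :=
  forall k j k' j' : nat, k%:Z - j%:Z = k'%:Z - j'%:Z -> A k j = A k' j'.

End OperatorMatrices.

Definition unit_circle (R : realType) : set (C R) := [set z | `|z| = 1].

(* Points of T are the complex numbers e^{it} rather than t in [0, 2pi), so that
   open and compact sets are those of the circle (set types carry the subspace
   topology). *)
Definition circle (R : realType) : topologicalType :=
  set_type (@unit_circle R).

Definition borel (R : realType) : set (set (circle R)) := <<s open >>.

(* e^{ikt} = z ^ k at z = e^{it}. *)
Definition phi (R : realType) (k : int) (z : circle R) : C R :=
  (set_val z : C R) ^ k.

Section VectorMeasures.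
Context {R : realType} {E : normedModType (C R)}.
Implicit Types (mu : set (circle R) -> E) (f s : circle R -> C R).

(* Values of mu outside the Borel sets are irrelevant. *)
Definition vector_measure mu : Prop :=
  forall A : nat -> set (circle R), (forall n, borel (A n)) -> trivIset setT A ->
    (fun n => \sum_(i < n) mu (A i)) @ \oo --> mu (\bigcup_n A n).

Definition borel_partition n (A : 'I_n -> set (circle R)) B : Prop :=
  [/\ forall i, borel (A i), trivIset setT A & \bigcup_i A i = B].

Definition vector_variation mu (B : set (circle R)) : \bar R :=
  ereal_sup [set v | exists n (A : 'I_n -> set (circle R)),
    borel_partition A B /\ v = (\sum_(i < n) rnorm (mu (A i)))%:E].

End VectorMeasures.

Section RegularMeasures.
Context {R : realType} {E : normedModType (C R)}.
Implicit Types (mu : set (circle R) -> E) (f s : circle R -> C R).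

(* The dual of E is bop E (C R). The supremum of an empty set of nonnegative
   numbers is 0 (relevant when E = 0, where no functional has norm 1). *)
Definition semivariation mu (B : set (circle R)) : \bar R :=
  ereal_sup (0%E |` [set vector_variation (fun A => e (mu A)) B |
                       e in [set e : bop E (C R) | `|e| = 1]]).

Definition regular_measure mu : Prop :=
  forall (eps : R) (B : set (circle R)), 0 < eps -> borel B ->
    exists K O : set (circle R),
      [/\ compact K, open O, K `<=` B, B `<=` O &
          (semivariation mu (O `\` K) < eps%:E)%E].

Definition regular_vector_measure mu : Prop := vector_measure mu /\ regular_measure mu.

Definition bv_vector_measure mu : Prop :=
  regular_vector_measure mu /\ (vector_variation mu setT < +oo)%E.

Definition simple_fun s : Prop :=
  finite_set (range s) /\ forall c : C R, borel (s @^-1` [set c]).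

Definition simple_integral mu s : E :=
  \sum_(c \in range s) c *: mu (s @^-1` [set c]).

(* For a countably additive mu, the limit does not depend on the sequence s of
   simple functions converging uniformly to f. *)
Definition is_vintegral mu f (e : E) : Prop :=
  exists s : nat -> circle R -> C R,
    [/\ forall n, simple_fun (s n),
        forall eps : R, 0 < eps ->
          \forall n \near \oo, forall t, rnorm (f t - s n t) < eps &
        simple_integral mu (s n) @[n --> \oo] --> e].

Definition vintegral mu f : E := get (is_vintegral mu f).

Definition fourier mu (k : int) : E := vintegral mu (phi k).

End RegularMeasures.

Section SOTMeasures.
Context {R : realType} {H : normedModType (C R)}.
Implicit Types mu : set (circle R) -> bop H H.

Definition eval_measure mu (x : H) : set (circle R) -> H := fun A => mu A x.

Definition M_SOT mu : Prop :=
  regular_vector_measure mu /\ forall x, bv_vector_measure (eval_measure mu x).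

Definition SOT_norm mu : \bar R :=
  ereal_sup (0%E |` [set vector_variation (eval_measure mu x) setT |
                       x in [set x : H | `|x| = 1]]).

End SOTMeasures.

(* Main.v *)
(* Write T_l for the entry on the diagonal j - k = l. Testing A on the circulant blocks
   <., y_(j - k)> e, contractive by Plancherel, gives a discrete L^1 bound
   (1/m) sum_i |sigma_N(w^i) x| <= c |x| for the Fejer means sigma_N of sum_l T_l z^(-l), w being a
   primitive m-th root of unity; c is any bound for the multiplier, and some c exists because
   counterexamples of growing size could be assembled into one block diagonal matrix. Hence the
   discrete measures with densities sigma_N(.) x converge on trigonometric polynomials, and by
   density on continuous functions f, to some Phi(f) x, while their variations have a finitely
   additive limit L_x along an ultrafilter. Regularizing L_x gives a finite Borel regular v_x with
   |Phi(f) x| <= v_x({f <> 0}) for |f| <= 1, so that Phi(.) x extends to indicators of Borel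
   sets: this is mu. Norm countable additivity and norm regularity of mu are automatic: x |-> v_x(B)
   is a seminorm, and in a Hilbert space K seminorms p_k with sum_k p_k <= c |.| cannot all exceed d
   on the unit ball once K d^2 > c (c + 1); so v_x(D_n) -> 0 for every x and decreasing D_n implies
   uniform convergence on the unit ball. *)
Require Import Defs.
From HB Require Import structures.
From mathcomp Require Import all_boot all_order all_algebra cyclic separable cyclotomic.
From mathcomp.real_closed Require Import complex.
From mathcomp Require Import all_classical all_reals all_analysis.
From mathcomp Require Import finmap ring lra zify.

Import Order.TTheory GRing.Theory Num.Theory.
Import numFieldNormedType.Exports.

Set Implicit Arguments.
Unset Strict Implicit.
Unset Printing Implicit Defensive.

Local Open Scope classical_set_scope.
Local Open Scope ring_scope.

(** * Norms and roots of unity *)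

Section ComplexNorm.
Variable R : realType.
Implicit Types (a b : C R).

(** The entries of A prescribe every Fourier coefficient, so the discrete integrals converge in norm
    on trigonometric polynomials and Phi needs no weak compactness of vector measures. Only the
    variations require a compactness argument, and a scalar one: an ultrafilter limit of bounded
    numbers, taken simultaneously for all x and all sets. This keeps L_x a seminorm in x, which
    subsequences chosen separately for each x would not do, and the passage from pointwise to
    uniform estimates feeds on exactly that. L_x lives on all subsets and may count mass that merely
    approaches a boundary; hence the regularization, under which the seminorm property survives. Two
    constants are kept apart. The infimum defining the multiplier norm could a priori run over an
    empty set, so a qualitative c is produced beforehand and drives the construction. L_x does not
    depend on c, so each admissible constant d bounds the same mu, and the infimum is taken only at
    the end. *)

Lemma rnormM a b : rnorm (a * b) = rnorm a * rnorm b.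
Proof. by apply: RtoC_inj; rewrite RtoCM !rnormE normrM. Qed.

Lemma rnormV a : rnorm a^-1 = (rnorm a)^-1.
Proof. by apply: RtoC_inj; rewrite RtoCV !rnormE normfV. Qed.

Lemma rnorm1 : rnorm (1 : C R) = 1.
Proof. by apply: RtoC_inj; rewrite rnormE normr1. Qed.

Lemma RtoC_sum (I : Type) (r : seq I) (P : pred I) (F : I -> R) :
  RtoC (\sum_(i <- r | P i) F i) = \sum_(i <- r | P i) RtoC (F i).
Proof. exact: (rmorph_sum (real_complex R)). Qed.

Lemma RtoCX (r : R) n : RtoC (r ^+ n) = RtoC r ^+ n.
Proof. exact: (rmorphXn (real_complex R)). Qed.

Lemma RtoC_nat n : RtoC (n%:R : R) = n%:R.
Proof. exact: (rmorph_nat (real_complex R)). Qed.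

Lemma rnorm_RtoC (r : R) : rnorm (RtoC r) = `|r|.
Proof.
apply: RtoC_inj; rewrite rnormE.
have [r0|r0] := leP 0 r.
  by rewrite [LHS]ger0_norm ?(ler_RtoC 0) // ger0_norm.
have -> : RtoC r = - RtoC (- r) by rewrite /RtoC rmorphN /= opprK.
by rewrite normrN [LHS]ger0_norm ?(ler_RtoC 0) ?oppr_ge0 1?ltW // ltr0_norm.
Qed.

Lemma rnorm_nat n : rnorm (n%:R : C R) = n%:R.
Proof. by rewrite -RtoC_nat rnorm_RtoC ger0_norm. Qed.

Lemma rnorm_distrC (V : normedModType (C R)) (x y : V) : rnorm (x - y) = rnorm (y - x).
Proof. by rewrite /rnorm distrC. Qed.

Lemma rnormN (V : normedModType (C R)) (x : V) : rnorm (- x) = rnorm x.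
Proof. by rewrite /rnorm normrN. Qed.

Lemma ball_rnorm (V : normedModType (C R)) (x y : V) (e : R) :
  ball x (RtoC e) y = (rnorm (x - y) < e).
Proof. by rewrite -ball_normE /ball_ /= -rnormE ltcR. Qed.

Lemma nbhs_rnormP (V : normedModType (C R)) (x : V) (P : set V) :
  nbhs x P <-> exists2 e : R, 0 < e & forall y, rnorm (x - y) < e -> P y.
Proof.
split.
  move=> /nbhs_ballP[e /= e0 eP].
  have eE : RtoC (complex.Re e) = e by apply/RRe_real/gtr0_real.
  exists (complex.Re e); first by move: e0; rewrite -{1}eE (ltcR 0).
  by move=> y; rewrite -ball_rnorm eE; exact: eP.
move=> [e e0 eP]; apply/nbhs_ballP; exists (RtoC e); first by rewrite /= (ltcR 0).
by move=> y; rewrite ball_rnorm; exact: eP.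
Qed.

(** X^n - 1 splits and is separable, so it has n distinct roots, and n distinct n-th roots of unity
    include a primitive one. *)
Lemma prim_root_exists n : (n > 0)%N -> exists w : C R, n.-primitive_root w.
Proof.
pose p : {poly C R} := 'X^n - 1; have [r Dp] := closed_field_poly_normal p.
move=> n_gt0; rewrite (monicP _) ?monicXnsubC // scale1r in Dp.
have rn1 : all n.-unity_root r by apply/allP=> z; rewrite -root_prod_XsubC -Dp.
have sz_r : (n < (size r).+1)%N.
  by rewrite -(size_prod_XsubC r id) -Dp size_XnsubC.
have [|z] := hasP (has_prim_root n_gt0 rn1 _ sz_r); last by exists z.
by rewrite -separable_prod_XsubC -Dp separable_Xn_sub_1 // pnatr_eq0 -lt0n.
Qed.

Lemma norm_unity_root (w : C R) n : (n > 0)%N -> w ^+ n = 1 -> `|w| = 1.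
Proof.
move=> n0 wn; apply/eqP; rewrite -(@pexpr_eq1 _ _ n) // -normrX wn.
by rewrite normr1.
Qed.

Lemma conj_unity_root (w : C R) n : (n > 0)%N -> w ^+ n = 1 -> w^* = w^-1.
Proof.
move=> n0 wn; have w1 := norm_unity_root n0 wn.
have w0 : w != 0 by rewrite -normr_eq0 w1 oner_neq0.
by apply: (mulfI w0); rewrite -normCK w1 expr1n mulfV.
Qed.

(** Orthogonality of the characters of Z/m: a geometric sum whose ratio is a root of unity
    telescopes to 0 unless the ratio is 1. *)
Lemma prim_root_sum (w : C R) m (l : int) : m.-primitive_root w ->
  \sum_(j < m) (w ^ l) ^+ j = if (m%:Z %| l)%Z then m%:R else 0.
Proof.
move=> hw; have m0 := prim_order_gt0 hw.
have w0 : w != 0 by rewrite (prim_root_eq0 hw) -lt0n.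
have wu : w \is a GRing.unit by rewrite unitfE.
have wlE : (w ^ l == 1) = (m%:Z %| l)%Z.
  rewrite dvdzE /= (prim_order_dvd hw); case: l => k /=; first by [].
  by rewrite NegzE -exprnN invr_eq1.
rewrite -wlE; case: ifPn => [/eqP->|wl1].
  by under eq_bigr do rewrite expr1n; rewrite sumr_const card_ord.
have : (w ^ l) ^+ m = 1 by rewrite exprnP exprzAC -exprnP prim_expr_order // exp1rz.
move/eqP; rewrite -subr_eq0 subrX1 mulf_eq0 subr_eq0 (negPf wl1) /=.
by move/eqP.
Qed.

End ComplexNorm.

(** * Cauchy-Schwarz and the discrete Plancherel identity *)

Section Dot.
Variables (R : realType) (H : normedModType (C R)).
Variables (dot : {dot H for Num.conj}) (dotE : forall x : H, dot x x = `|x| ^+ 2).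

Lemma dotZl a x y : dot (a *: x) y = a * dot x y.
Proof. by rewrite linearZl_LR. Qed.

Lemma dotZr a x y : dot x (a *: y) = a^* * dot x y.
Proof. by rewrite linearZr_LR. Qed.

Lemma dotxx x : dot x x = RtoC (rnorm x ^+ 2).
Proof. by rewrite dotE RtoCX rnormE. Qed.

Lemma cauchy_schwarz x y : rnorm (dot x y) <= rnorm x * rnorm y.
Proof.
have [->|y0] := eqVneq y 0; first by rewrite linear0r !rnorm0 mulr0.
have ny : rnorm y != 0 by apply: contra_neq y0; exact: rnorm_eq0.
have yp : 0 < rnorm y by rewrite lt_def ny rnorm_ge0.
(* [b *: y] is the orthogonal projection of x on the line of y; the inequality is the positivity of
   |x - b y|^2. *)
set a := dot x y; pose b := a / dot y y.
have yy0 : dot y y != 0 by rewrite dnorm_eq0.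
have yyc : (dot y y)^* = dot y y by rewrite [RHS]hermC /= expr0 mul1r.
have : 0 <= dot (x - b *: y) (x - b *: y) by rewrite dnorm_ge0.
rewrite linearBl /= linearBr /= [X in _ - X]linearBr /= !dotZl !dotZr -/a.
rewrite [dot y x]hermC /= expr0 mul1r -/a.
have bE : b^* = a^* / dot y y by rewrite /b rmorphM /= fmorphV /= yyc.
rewrite bE divfK // subrr subr0 mulrAC -normCKC.
rewrite !dotxx -(rnormE a) -RtoCX -RtoCV -RtoCM subr_ge0 ler_RtoC.
rewrite ler_pdivrMr ?exprn_gt0 // -exprMn.
by rewrite ler_pXn2r // nnegrE ?mulr_ge0 ?rnorm_ge0.
Qed.

Lemma rnorm_sqr_sum (I : Type) (r : seq I) (F : I -> H) :
  RtoC (rnorm (\sum_(i <- r) F i) ^+ 2) =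
  \sum_(i <- r) \sum_(j <- r) dot (F i) (F j).
Proof.
rewrite -dotxx linear_sumlz /=; apply: eq_bigr => i _.
by rewrite linear_sumr.
Qed.

(** Discrete Fourier transform of length m of a sequence supported on N <= m indices: distinct
    indices differ by less than m, so the cross terms vanish. *)
Lemma plancherel (w : C R) m N (u : nat -> H) :
  m.-primitive_root w -> (N <= m)%N ->
  \sum_(j < m) rnorm (\sum_(k < N) w ^+ (j * k) *: u k) ^+ 2 =
  m%:R * \sum_(k < N) rnorm (u k) ^+ 2.
Proof.
move=> hw Nm; have m0 := prim_order_gt0 hw.
have w0 : w != 0 by rewrite (prim_root_eq0 hw) -lt0n.
have wu : w \is a GRing.unit by rewrite unitfE.
have termE j k l : dot (w ^+ (j * k) *: u k) (w ^+ (j * l) *: u l) =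
    (w ^ (k%:Z - l%:Z)) ^+ j * dot (u k) (u l).
  rewrite dotZl dotZr mulrA; congr (_ * _).
  rewrite rmorphXn /= (conj_unity_root m0 (prim_expr_order hw)).
  rewrite expfzDr // -exprz_inv -!exprnP exprMn -!exprM.
  by rewrite ![(j * _)%N]mulnC.
apply: RtoC_inj; rewrite RtoCM RtoC_nat !RtoC_sum mulr_sumr.
under eq_bigr do rewrite rnorm_sqr_sum.
rewrite exchange_big /=; apply: eq_bigr => k _.
rewrite exchange_big /= (bigD1 k) //= [X in _ + X]big1 ?addr0 => [|l lk].
  under eq_bigr do rewrite termE subrr expr0z expr1n mul1r dotxx.
  by rewrite sumr_const card_ord mulr_natl.
under eq_bigr do rewrite termE.
rewrite -mulr_suml prim_root_sum //; case: ifPn; rewrite ?mul0r //.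
rewrite dvdzE /= => /dvdn_leq mkl; exfalso.
suff /mkl : (0 < `|k%:Z - l%:Z|)%N.
  have := ltn_ord k; have := ltn_ord l; lia.
by rewrite absz_gt0 subr_eq0; apply: contra lk => /eqP[/val_inj->].
Qed.
End Dot.

(** * Schur multipliers on finite blocks *)

Section L2.
Variables (R : realType) (H : normedModType (C R)).
Implicit Types (x u : nat -> H) (A B M : op_matrix H).

Definition trunc N u : nat -> H := fun j => if (j < N)%N then u j else 0.

Lemma c00_trunc N u : c00 (trunc N u).
Proof.
apply: (@sub_finite_set _ _ `I_N); last exact: finite_II.
by move=> j /=; rewrite /trunc; case: ifP; rewrite ?eqxx.
Qed.

Lemma c00P x : c00 x -> exists N, x = trunc N x.
Proof.
move=> fx.
have [N NP] : exists N, forall j, x j != 0 -> (j < N)%N.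
  exists (\sum_(j <- fset_set [set j | x j != 0%R]) j).+1%N => j xj.
  rewrite ltnS (big_rem j) /= ?leq_addr //.
  by rewrite in_fset_set //; exact: mem_set.
exists N; apply/funext => j; rewrite /trunc; case: ifPn => // jN.
by apply/eqP; apply: contraNT jN => /NP.
Qed.

Lemma mxapply_trunc M N u k :
  mxapply M (trunc N u) k = \sum_(j < N) M k j (u j).
Proof.
rewrite /mxapply -(fsbig_widen `I_N [set: nat]) //=; last first.
  by move=> j [_ /= /negP]; rewrite /trunc -leqNgt ltnNge => ->; rewrite linear0.
rewrite -fsbig_ord; apply: eq_bigr => j _.
by rewrite /trunc ltn_ord.
Qed.

Lemma l2norm_le x (c : R) :
  (forall K, \sum_(k < K) rnorm (x k) ^+ 2 <= c) ->
  (l2norm x <= (Num.sqrt c)%:E)%E.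
Proof.
move=> xc; have c0 : 0 <= c by apply: le_trans (xc 0%N); rewrite big_ord0.
rewrite -[(Num.sqrt c)%:E]/(sqrte c%:E) /l2norm lee_sqrt ?lee_fin //.
apply: lime_le; first by apply: is_cvg_nneseries => n _ _; rewrite lee_fin sqr_ge0.
by apply: nearW => K; rewrite sumEFin lee_fin big_mkord.
Qed.

Lemma l2norm_ge x (c : R) K : (l2norm x <= (Num.sqrt c)%:E)%E -> 0 <= c ->
  \sum_(k < K) rnorm (x k) ^+ 2 <= c.
Proof.
rewrite -[(Num.sqrt c)%:E]/(sqrte c%:E) /l2norm => + c0.
rewrite lee_sqrt ?lee_fin // => xc.
rewrite -lee_fin -sumEFin -(big_mkord xpredT (fun k => (rnorm (x k) ^+ 2)%:E)).
apply: le_trans xc; apply: nneseries_lim_ge => k _ _.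
by rewrite lee_fin sqr_ge0.
Qed.

Lemma l2norm_trunc N u :
  l2norm (trunc N u) = (Num.sqrt (\sum_(j < N) rnorm (u j) ^+ 2))%:E.
Proof.
have s0 K : 0 <= \sum_(j < K) rnorm (trunc N u j) ^+ 2.
  by apply: sumr_ge0 => j _; exact: sqr_ge0.
have tE : \sum_(j < N) rnorm (u j) ^+ 2 = \sum_(j < N) rnorm (trunc N u j) ^+ 2.
  by apply: eq_bigr => j _; rewrite /trunc ltn_ord.
rewrite tE; apply/eqP; rewrite eq_le; apply/andP; split.
  apply: l2norm_le => K.
  have [NK|KN] := leqP N K.
    rewrite -(big_mkord xpredT (fun j => rnorm (trunc N u j) ^+ 2)).
    rewrite (big_cat_nat (n := N)) //= big_mkord [X in _ + X]big_nat.
    rewrite [X in _ + X]big1 ?addr0 // => i /andP[Ni _].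
    by rewrite /trunc ltnNge Ni rnorm0 expr0n.
  rewrite -(big_mkord xpredT (fun j => rnorm (trunc N u j) ^+ 2)).
  rewrite -(big_mkord xpredT (fun j => rnorm (trunc N u j) ^+ 2)).
  rewrite [leRHS](big_cat_nat (n := K)) //= ?(ltnW KN) // lerDl sumr_ge0 // => i _.
  exact: sqr_ge0.
rewrite -[(Num.sqrt _)%:E]/(sqrte (_)%:E) /l2norm lee_sqrt.
  rewrite -sumEFin -(big_mkord xpredT (fun k => (rnorm (trunc N u k) ^+ 2)%:E)).
  by apply: nneseries_lim_ge => k _ _; rewrite lee_fin sqr_ge0.
by apply: nneseries_ge0 => k _ _; rewrite lee_fin sqr_ge0.
Qed.

(** Removes the extended reals: columns are cut at N because vectors are finitely supported, rows at
    K because images need not be. *)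
Lemma l2boundP M (c : R) : 0 <= c ->
  l2bound M c <-> forall N K u,
    \sum_(k < K) rnorm (\sum_(j < N) M k j (u j)) ^+ 2 <=
    c ^+ 2 * \sum_(j < N) rnorm (u j) ^+ 2.
Proof.
move=> c0.
have sE N u : (c%:E * l2norm (trunc N u) =
    (Num.sqrt (c ^+ 2 * \sum_(j < N) rnorm (u j) ^+ 2))%:E)%E.
  by rewrite l2norm_trunc -EFinM sqrtrM ?sqr_ge0 // sqrtr_sqr ger0_norm.
split=> [[_ Mc] N K u|Mc].
  under eq_bigr do rewrite -mxapply_trunc.
  have := Mc _ (c00_trunc N u); rewrite sE => /l2norm_ge; apply.
  by rewrite mulr_ge0 ?sqr_ge0 // sumr_ge0 // => j _; exact: sqr_ge0.
split=> // x /c00P[N ->]; rewrite sE; apply: l2norm_le => K.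
by under eq_bigr do rewrite mxapply_trunc; exact: Mc.
Qed.

(** Padding with zeros embeds any corner in a larger square one, so arbitrarily large square corners
    suffice. *)
Lemma l2bound_squares M (c : R) : 0 <= c ->
  (forall K0, exists2 K, (K0 <= K)%N & forall u,
    \sum_(k < K) rnorm (\sum_(j < K) M k j (u j)) ^+ 2 <=
    c ^+ 2 * \sum_(j < K) rnorm (u j) ^+ 2) ->
  l2bound M c.
Proof.
move=> c0 Mc; apply/l2boundP => // N K u.
have [K' KK' {}Mc] := Mc (maxn N K).
have [NK' KK] : (N <= K')%N /\ (K <= K')%N by rewrite !(leq_trans _ KK') ?leq_maxl ?leq_maxr.
have trE (V : nmodType) (F G : nat -> V) : (forall j, (j < N)%N -> F j = G j) ->
    (forall j, (N <= j)%N -> G j = 0) -> \sum_(j < N) F j = \sum_(j < K') G j.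
  move=> FG G0; rewrite -!(big_mkord xpredT) (big_cat_nat (n := N) (p := K')) //=.
  rewrite [X in _ + X]big_nat [X in _ + X]big1 ?addr0; last by move=> j /andP[/G0].
  by rewrite !big_mkord; apply: eq_bigr => j _; rewrite FG.
have {Mc} := Mc (trunc N u).
have <- : \sum_(j < N) rnorm (u j) ^+ 2 = \sum_(j < K') rnorm (trunc N u j) ^+ 2.
  apply: (trE _ (fun j => rnorm (u j) ^+ 2) (fun j => rnorm (trunc N u j) ^+ 2)) =>
    j jN; rewrite /trunc ?jN // ltnNge jN.
  by rewrite rnorm0 expr0n.
apply: le_trans.
rewrite -(big_mkord xpredT (fun k => rnorm (\sum_(j < N) M k j (u j)) ^+ 2)).
rewrite -(big_mkord xpredT (fun k => rnorm (\sum_(j < K') M k j (trunc N u j)) ^+ 2)).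
rewrite [leRHS](big_cat_nat (n := K)) //= ler_wpDr //.
  by apply: sumr_ge0 => k _; exact: sqr_ge0.
rewrite le_eqVlt; apply/orP; left; apply/eqP/eq_bigr => k _; congr (rnorm _ ^+ 2).
apply: (trE _ (fun j => M k j (u j)) (fun j => M k j (trunc N u j))) => j jN;
  rewrite /trunc ?jN // ltnNge jN.
by rewrite linear0.
Qed.

Definition block_contractive N (b : op_matrix H) := forall u,
  \sum_(k < N) rnorm (\sum_(j < N) b k j (u j)) ^+ 2 <=
  \sum_(j < N) rnorm (u j) ^+ 2.

(** One constant for blocks of all sizes; later estimates use the multiplier hypothesis only in this
    form. *)
Definition block_multiplier A (c : R) := forall N b, block_contractive N b ->
  forall u, \sum_(k < N) rnorm (\sum_(j < N) b k j (A k j (u j))) ^+ 2 <=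
    c ^+ 2 * \sum_(j < N) rnorm (u j) ^+ 2.

(* The blocks of a Toeplitz matrix along its diagonal do not depend on their
   position, so B * A sees every b n * A. *)
Lemma block_diagonal A (N : nat -> nat) (b : nat -> op_matrix H) :
  toeplitz A -> (forall n, (0 < N n)%N) ->
  (forall n, block_contractive (N n) (b n)) ->
  exists2 B, l2bound B 1 & forall c, l2bound (schur_prod B A) c ->
    forall n u, \sum_(k < N n) rnorm (\sum_(j < N n) b n k j (A k j (u j))) ^+ 2 <=
      c ^+ 2 * \sum_(j < N n) rnorm (u j) ^+ 2.
Proof.
move=> At N0 bc; pose o n := (\sum_(i < n) N i)%N.
have oS n : o n.+1 = (o n + N n)%N by rewrite /o big_ord_recr.
have omono m n : (m <= n)%N -> (o m <= o n)%N.
  move=> /subnK <-; elim: (n - m)%N => // d IH.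
  by rewrite addSn oS (leq_trans IH) // leq_addr.
have on n : (n <= o n)%N.
  elim: n => // n IH; rewrite oS -addn1 leq_add //; exact: N0.
have /choice[blk hblk] : forall k, exists n, (o n <= k < o n.+1)%N.
  elim=> [|k [n /andP[ok ko]]]; first by exists 0%N; rewrite oS /o big_ord0 add0n N0.
  have [ko'|ko'] := ltnP k.+1 (o n.+1); first by exists n; rewrite ko' (leq_trans ok).
  by exists n.+1; rewrite ko' oS; have := N0 n.+1; move: ko ko'; lia.
have blkE n i : (i < N n)%N -> blk (o n + i)%N = n.
  move=> iN; have /andP[h1 h2] := hblk (o n + i)%N.
  have [h|h|//] := ltngtP (blk (o n + i)%N) n; exfalso.
    by have := omono _ _ h; lia.
  by have := omono _ _ h; rewrite oS; lia.
have blk_lt n k : (k < o n)%N -> (blk k < n)%N.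
  move=> kn; have /andP[h1 h2] := hblk k; rewrite ltnNge; apply/negP => /omono.
  lia.
pose B k j := if blk k == blk j then b (blk k) (k - o (blk k))%N (j - o (blk k))%N else 0.
have B_in n i j : (i < N n)%N -> (j < N n)%N -> B (o n + i)%N (o n + j)%N = b n i j.
  by move=> iN jN; rewrite /B !blkE // eqxx !addKn.
have B_out k j : blk k != blk j -> B k j = 0 by rewrite /B => /negPf ->.
exists B.
  apply: l2bound_squares => // K0; exists (o K0) => // u.
  rewrite expr1n mul1r; elim: K0 => [|n IH].
    by rewrite /o !big_ord0.
  rewrite oS !big_split_ord /=; apply: lerD.
    apply: le_trans IH; apply: ler_sum => k _; rewrite big_split_ord /=.
    rewrite [X in _ + X]big1 ?addr0 // => j _; rewrite B_out // blkE //.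
    by have /blk_lt := ltn_ord k; rewrite neq_ltn => ->.
  apply: le_trans (bc n (fun j => u (o n + j)%N)); apply: ler_sum => k _.
  rewrite big_split_ord /= [X in X + _]big1 ?add0r => [|j _].
    by under eq_bigr do rewrite B_in //.
  rewrite B_out // blkE //.
  by have /blk_lt := ltn_ord j; rewrite neq_ltn => ->; rewrite orbT.
move=> c cB n u; have c0 := cB.1; move/l2boundP in cB.
have := cB c0 (o n + N n)%N (o n + N n)%N
  (fun j => if (o n <= j)%N then u (j - o n)%N else 0).
rewrite !big_split_ord /= [X in _ <= _ * (X + _)]big1 ?add0r => [|j _].
  under [X in _ <= _ * X]eq_bigr do rewrite leq_addr addKn.
  apply: le_trans; rewrite ler_wpDl //; first by apply: sumr_ge0 => k _; exact: sqr_ge0.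
  apply: ler_sum => k _; rewrite big_split_ord /= [X in X + _]big1 ?add0r => [|j _].
    rewrite le_eqVlt; apply/orP; left; apply/eqP; congr (rnorm _ ^+ 2).
    apply: eq_bigr => j _; rewrite leq_addr addKn /= B_in //; congr (b n k j (_ _)).
    by apply: congr1; apply: At; rewrite !PoszD; ring.
  by rewrite leqNgt ltn_ord /= !linear0.
by rewrite leqNgt ltn_ord /= rnorm0 expr0n.
Qed.

(** A uniform boundedness principle by gluing: [right_multiplier] gives a bound for each B
    separately, with no uniformity in B. *)
Lemma block_multiplier_exists A : toeplitz A -> right_multiplier A ->
  exists2 c, 0 <= c & block_multiplier A c.
Proof.
move=> At Am; apply: contrapT => noc.
have /choice[F hF] : forall n : nat, exists F : nat * op_matrix H * (nat -> H),
    [/\ (0 < F.1.1)%N, block_contractive F.1.1 F.1.2 &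
    n%:R ^+ 2 * \sum_(j < F.1.1) rnorm (F.2 j) ^+ 2 <
    \sum_(k < F.1.1) rnorm (\sum_(j < F.1.1) F.1.2 k j (A k j (F.2 j))) ^+ 2].
  (* An empty block satisfies every bound, so counterexamples have positive size, as the gluing
     requires. *)
  move=> n; apply: contrapT => noF; apply: noc; exists n%:R => // -[|N] b bN u.
    by rewrite !big_ord0 mulr0.
  rewrite leNgt; apply/negP => lt_; apply: noF.
  by exists (N.+1, b, u).
have [B B1 BA] : exists2 B, l2bound B 1 & forall c, l2bound (schur_prod B A) c ->
    forall n u, \sum_(k < (F n).1.1) rnorm (\sum_(j < (F n).1.1)
      (F n).1.2 k j (A k j (u j))) ^+ 2 <= c ^+ 2 * \sum_(j < (F n).1.1) rnorm (u j) ^+ 2.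
  by apply: (@block_diagonal A (fun n => (F n).1.1) (fun n => (F n).1.2)) => // n;
    have [] := hF n.
have [c cBA] := Am B (ex_intro _ 1 B1).
have [c0 _] := cBA; have [_ _] := hF (Num.bound c).
rewrite ltNge => /negP; apply; apply: le_trans (BA _ cBA _ _) _.
rewrite ler_wpM2r //; first by apply: sumr_ge0 => j _; exact: sqr_ge0.
by rewrite ler_pXn2r ?nnegrE // ltW // archi_boundP.
Qed.

(** The same block is repeated along the diagonal, so B has norm at most 1 and the constant is not
    degraded. The infimum [Bl2norm] is only approached, hence a bound d < c + e of the product, with
    e tending to 0. *)
Lemma block_multiplier_norm A (c : R) : toeplitz A -> 0 <= c ->
  (forall B, l2bounded B -> (Bl2norm (schur_prod B A) <= c%:E * Bl2norm B)%E) ->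
  block_multiplier A c.
Proof.
move=> At c0 Ac [|N] b bN u; first by rewrite !big_ord0 mulr0.
have [B B1 BA] := block_diagonal (b := fun=> b) At (fun=> ltn0Sn N) (fun=> bN).
have nB : (Bl2norm B <= 1%:E)%E by apply: ereal_inf_lbound; exists 1.
have nBA : (Bl2norm (schur_prod B A) <= c%:E)%E.
  apply: (le_trans (Ac B (ex_intro _ 1 B1))).
  by rewrite -[leRHS]mule1 lee_wpmul2l.
set S := \sum_(k < _) _; set T := \sum_(j < _) _.
have T0 : 0 <= T by apply: sumr_ge0 => j _; exact: sqr_ge0.
(* A zero vector has no norm to divide by; any finite bound of the product settles this case. *)
have [T00|Tp] := eqVneq T 0.
  move: nBA; rewrite T00 mulr0 => nBA.
  have /ereal_inf_lt[_ [d dBA <-] _] : (Bl2norm (schur_prod B A) < (c + 1)%:E)%E.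
    by apply: le_lt_trans nBA _; rewrite lte_fin ltrDl.
  by have := BA _ dBA 0%N u; rewrite -/S -/T T00 mulr0.
have {}Tp : 0 < T by rewrite lt_def Tp.
rewrite -ler_sqrt ?mulr_ge0 ?sqr_ge0 // sqrtrM ?sqr_ge0 // sqrtr_sqr ger0_norm //.
rewrite -ler_pdivrMr ?sqrtr_gt0 //; apply/ler_addgt0Pr => e e0.
have /ereal_inf_lt[_ [d dBA <-]] : (Bl2norm (schur_prod B A) < (c + e)%:E)%E.
  by apply: le_lt_trans nBA _; rewrite lte_fin ltrDl.
rewrite lte_fin => dce; have d0 := dBA.1.
rewrite ler_pdivrMr ?sqrtr_gt0 //.
apply: (@le_trans _ _ (d * Num.sqrt T)); last by rewrite ler_wpM2r ?sqrtr_ge0 // ltW.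
rewrite -[d in leRHS]ger0_norm // -sqrtr_sqr -sqrtrM ?sqr_ge0 //.
by rewrite ler_sqrt ?mulr_ge0 ?sqr_ge0 //; exact: BA.
Qed.

End L2.

(** * The Fejer means are bounded in variation *)

Section Bop.
Variables (R : realType) (E F : normedModType (C R)).

Lemma bop_addE (f g : bop E F) x : (f + g) x = f x + g x.
Proof. by []. Qed.

Lemma bop_oppE (f : bop E F) x : (- f) x = - f x.
Proof. by []. Qed.

Lemma bop_scaleE a (f : bop E F) x : (a *: f) x = a *: f x.
Proof. by []. Qed.

Lemma bop_sumE (I : Type) (r : seq I) (P : pred I) (f : I -> bop E F) x :
  (\sum_(i <- r | P i) f i) x = \sum_(i <- r | P i) f i x.
Proof. by elim/big_rec2: _ => // i y g _ <-. Qed.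

Lemma bopP (f g : bop E F) : (forall x, f x = g x) -> f = g.
Proof. by move=> fg; apply/val_inj/funext. Qed.

End Bop.

Lemma rnorm_sum (R : realType) (V : normedModType (C R)) (I : Type) (r : seq I)
  (P : pred I) (F : I -> V) :
  rnorm (\sum_(i <- r | P i) F i) <= \sum_(i <- r | P i) rnorm (F i).
Proof.
elim/big_rec2: _ => [|i y x _ xy]; first by rewrite rnorm0.
by apply: le_trans (rnormD _ _) _; rewrite lerD2l.
Qed.

Lemma sqr_sum_le (R : realFieldType) N (a : 'I_N -> R) :
  (\sum_(k < N) a k) ^+ 2 <= N%:R * \sum_(k < N) a k ^+ 2.
Proof.
rewrite expr2 mulr_suml; under eq_bigr do rewrite mulr_sumr.
apply: (@le_trans _ _ (\sum_(i < N) \sum_(j < N) ((a i ^+ 2 + a j ^+ 2) / 2))).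
  apply: ler_sum => i _; apply: ler_sum => j _.
  have := sqr_ge0 (a i - a j); nra.
under eq_bigr do rewrite -mulr_suml big_split /= sumr_const card_ord -[_ *+ N]mulr_natl.
rewrite -mulr_suml big_split /= -mulr_sumr sumr_const card_ord -[_ *+ N]mulr_natl.
by rewrite le_eqVlt; apply/orP; left; apply/eqP; field.
Qed.

Section RankOne.
Variables (R : realType) (H : normedModType (C R)).
Variables (dot : {dot H for Num.conj}) (dotE : forall x : H, dot x x = `|x| ^+ 2).

Lemma rank_one_subproof (y e : H) :
  (fun h => dot h y *: e) \in @bounded_linear_pred R H H.
Proof.
apply/mem_set; split=> [a x z|]; first by rewrite linearPl /= scalerDl scalerA.
exists (rnorm y * rnorm e) => x; rewrite rnormZ mulrAC ler_wpM2r ?rnorm_ge0 //.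
by rewrite mulrC; exact: cauchy_schwarz.
Qed.

Definition rank_one y e : bop H H := Bop (rank_one_subproof y e).

(** Since the inverse of 0 is 0, [direction 0] is 0: only norm at most 1 is guaranteed, but
    [dot_direction] holds without case distinction. *)
Definition direction (v : H) : H := RtoC (rnorm v)^-1 *: v.

Lemma direction_le1 v : rnorm (direction v) <= 1.
Proof.
rewrite rnormZ rnorm_RtoC ger0_norm ?invr_ge0 ?rnorm_ge0 //.
by have [->|v0] := eqVneq (rnorm v) 0; rewrite ?mulr0 // mulVf.
Qed.

Lemma dot_direction v : dot v (direction v) = RtoC (rnorm v).
Proof.
have RtoC_real (r : R) : (RtoC r)^* = RtoC r by exact: conjc_real.
rewrite dotZr dotxx // RtoC_real -RtoCM expr2 mulrA.
by have [->|v0] := eqVneq (rnorm v) 0; rewrite ?mulr0 // mulVf ?mul1r.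
Qed.

End RankOne.

Section CirculantBlock.
Variables (R : realType) (H : normedModType (C R)).
Variables (dot : {dot H for Num.conj}) (dotE : forall x : H, dot x x = `|x| ^+ 2).
Variables (w : C R) (m N : nat) (hw : m.-primitive_root w) (Nm : (N <= m)%N).
Variables (y : nat -> H) (e : H) (y1 : forall i, rnorm (y i) <= 1) (e1 : rnorm e = 1).

(** The entry is <., Y_(j - k)> e with Y_l = m^-1 sum_i w^(i l) y_i, the normalized discrete Fourier
    transform of y; conjugation in the second argument turns w^(i (j - k)) into w^(i (k - j)). *)
Definition circulant : op_matrix H := fun k j =>
  m%:R^-1 *: \sum_(i < m) (w ^+ (i * k) / w ^+ (i * j)) *: rank_one dotE (y i) e.

Lemma circulantE k j h : circulant k j h =
  m%:R^-1 *: \sum_(i < m) (w ^+ (i * k) / w ^+ (i * j) * dot h (y i)) *: e.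
Proof.
rewrite /circulant bop_scaleE bop_sumE; congr (_ *: _); apply: eq_bigr => i _.
by rewrite bop_scaleE scalerA.
Qed.

(** The Fourier transform diagonalizes the matrix: the i-th coefficient U_i of u is sent to <U_i,
    y_i> e, of norm at most |U_i|. Plancherel is applied once for w, after enlarging the rows from N
    to m, and once for w^-1; the two factors m cancel m^-2. *)
Lemma circulant_contractive : block_contractive N circulant.
Proof.
have m0 := prim_order_gt0 hw.
have mR : (0 : R) < m%:R by rewrite ltr0n.
have hwV : m.-primitive_root w^-1.
  by rewrite -(conj_unity_root m0 (prim_expr_order hw)) fmorph_primitive_root.
move=> u; pose U i := \sum_(j < N) w^-1 ^+ (i * j) *: u j.
pose g i := dot (U i) (y i).
have rowE k : \sum_(j < N) circulant k j (u j) =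
    m%:R^-1 *: \sum_(i < m) w ^+ (k * i) *: (g i *: e).
  under eq_bigr do rewrite circulantE.
  rewrite -scaler_sumr exchange_big /=; congr (_ *: _); apply: eq_bigr => i _.
  rewrite -scaler_suml scalerA; congr (_ *: _).
  rewrite /g /U linear_sumlz /= mulr_sumr; apply: eq_bigr => j _.
  by rewrite dotZl mulrA exprVn [(i * k)%N]mulnC.
under eq_bigr do rewrite rowE rnormZ exprMn.
rewrite -mulr_sumr rnormV rnorm_nat exprVn ler_pdivrMl ?exprn_gt0 //.
apply: (@le_trans _ _ (\sum_(k < m) rnorm (\sum_(i < m) w ^+ (k * i) *: (g i *: e)) ^+ 2)).
  rewrite -!(big_mkord xpredT (fun k => rnorm (\sum_(i < m) w ^+ (k * i) *: (g i *: e)) ^+ 2)).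
  rewrite [leRHS](big_cat_nat (n := N)) //= lerDl.
  by apply: sumr_ge0 => k _; exact: sqr_ge0.
rewrite (plancherel dotE (fun i => g i *: e) hw) //.
rewrite expr2 -mulrA ler_wpM2l // -(plancherel dotE u hwV Nm).
apply: ler_sum => i _; rewrite rnormZ e1 mulr1 ler_pXn2r ?nnegrE ?rnorm_ge0 //.
apply: le_trans (cauchy_schwarz dotE _ _) _.
by rewrite ler_piMr ?rnorm_ge0.
Qed.

End CirculantBlock.

Section DiscreteBound.
Variables (R : realType) (H : normedModType (C R)).
Variables (dot : {dot H for Num.conj}) (dotE : forall x : H, dot x x = `|x| ^+ 2).
Variables (A : op_matrix H) (c : R) (c0 : 0 <= c) (Ac : block_multiplier A c).

(* N times the N-th Fejer mean of the measure to be constructed *)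
Definition fejer N (z : C R) : bop H H :=
  \sum_(k < N) \sum_(j < N) (z ^+ k / z ^+ j) *: A k j.

Lemma fejerE N z x :
  fejer N z x = \sum_(k < N) \sum_(j < N) (z ^+ k / z ^+ j) *: A k j x.
Proof.
rewrite bop_sumE; apply: eq_bigr => k _; rewrite bop_sumE.
by apply: eq_bigr.
Qed.

(** With y_i the direction of the value at w^i and the constant sequence x as input, the outputs of
    the block product add up to the mean of the norms times e. Cauchy-Schwarz over the N rows costs
    sqrt N and the input has norm sqrt N |x|: together the factor N by which [fejer] exceeds the
    Fejer mean. *)
Lemma fejer_bound (w : C R) m N x : m.-primitive_root w -> (N <= m)%N ->
  \sum_(i < m) rnorm (fejer N (w ^+ i) x) <= m%:R * (N%:R * (c * rnorm x)).
Proof.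
move=> hw Nm; have m0 := prim_order_gt0 hw.
have mR : (0 : R) < m%:R by rewrite ltr0n.
have mC : m%:R != 0 :> C R by rewrite pnatr_eq0 -lt0n.
have [->|x0] := eqVneq x 0.
  by rewrite big1 ?rnorm0 ?mulr0 // => i _; rewrite linear0 rnorm0.
(* Any unit vector would serve; x is nonzero, so this is one. *)
pose e := direction x.
have e1 : rnorm e = 1.
  rewrite /e rnormZ rnorm_RtoC ger0_norm ?invr_ge0 ?rnorm_ge0 // mulVf //.
  by apply: contra_neq x0; exact: rnorm_eq0.
pose v i := fejer N (w ^+ i) x; pose y i := direction (v i).
have y1 i : rnorm (y i) <= 1 by exact: direction_le1.
have bc := circulant_contractive dotE hw Nm y1 e1.
pose b := circulant dotE w m y e.
have sumE : \sum_(k < N) \sum_(j < N) b k j (A k j x) =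
    RtoC (m%:R^-1 * \sum_(i < m) rnorm (v i)) *: e.
  under eq_bigr do under eq_bigr do rewrite circulantE.
  under eq_bigr do rewrite -scaler_sumr exchange_big.
  rewrite -scaler_sumr exchange_big /= RtoCM RtoCV RtoC_nat -scalerA; congr (_ *: _).
  rewrite RtoC_sum scaler_suml; apply: eq_bigr => i _.
  rewrite -(dot_direction dotE) /v {1}fejerE linear_sumlz /= scaler_suml.
  apply: eq_bigr => k _; rewrite linear_sumlz /= scaler_suml.
  by apply: eq_bigr => j _; rewrite dotZl -!exprM.
have := Ac bc (fun=> x); rewrite sumr_const card_ord -[_ ^+ 2 *+ _]mulr_natl => le1.
have s0 : 0 <= \sum_(i < m) rnorm (v i) by apply: sumr_ge0 => i _; exact: rnorm_ge0.
rewrite -ler_pdivrMl // -[_ <= _]ler_sqr ?nnegrE ?mulr_ge0 ?invr_ge0 ?rnorm_ge0 //.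
have -> : m%:R^-1 * \sum_(i < m) rnorm (v i) =
    rnorm (\sum_(k < N) \sum_(j < N) b k j (A k j x)).
  by rewrite sumE rnormZ e1 mulr1 rnorm_RtoC ger0_norm ?mulr_ge0 ?invr_ge0.
apply: (@le_trans _ _ ((\sum_(k < N) rnorm (\sum_(j < N) b k j (A k j x))) ^+ 2)).
  rewrite ler_pXn2r ?nnegrE ?rnorm_ge0 ?rnorm_sum //.
  by apply: sumr_ge0 => k _; exact: rnorm_ge0.
apply: le_trans (sqr_sum_le _) _.
rewrite !exprMn [N%:R ^+ 2]expr2 -mulrA ler_wpM2l //.
by apply: le_trans le1 _; rewrite mulrCA.
Qed.

End DiscreteBound.

(** * The circle *)

Section CircleTopology.
Variable R : realType.
Local Notation T := (circle R).
Local Notation cval := (fun t : T => set_val t : C R).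

Lemma norm_circle (t : T) : `|set_val t : C R| = 1.
Proof. by case: t => z /= zT; have := set_mem zT. Qed.

Lemma rnorm_circle (t : T) : rnorm (set_val t : C R) = 1.
Proof. by apply: RtoC_inj; rewrite rnormE norm_circle. Qed.

Lemma set_val_continuous : continuous cval.
Proof. exact: initial_continuous. Qed.

Lemma circle_hausdorff : hausdorff_space T.
Proof.
move=> p q pq; apply/val_inj.
have hC : hausdorff_space (C R) by exact: norm_hausdorff.
apply: hC => U V /set_val_continuous pU /set_val_continuous qV.
by have [t [Ut Vt]] := pq _ _ pU qV; exists (set_val t).
Qed.

Lemma circle_nbhs (t : T) (P : set T) : nbhs t P <->
  exists2 e : R, 0 < e & forall s, rnorm (set_val t - set_val s : C R) < e -> P s.
Proof.
split.
  move=> [Q [[W oW <-] /= Wt] WP].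
  have /nbhs_rnormP[e e0 eW] : nbhs (set_val t : C R) W by exact: open_nbhs_nbhs.
  by exists e => // s /eW /WP.
move=> [e e0 eP].
have : nbhs (set_val t : C R) [set z | rnorm (set_val t - z : C R) < e].
  by apply/nbhs_rnormP; exists e.
by move=> /set_val_continuous h; exact: (@filterS _ (nbhs t) _ _ _ eP h).
Qed.

Lemma rnorm_complex (a b : R) : rnorm ((a +i* b)%C : C R) = Num.sqrt (a ^+ 2 + b ^+ 2).
Proof. by []. Qed.

Lemma rnorm_Re_Im (a b : R) : rnorm ((a +i* b)%C : C R) <= `|a| + `|b|.
Proof.
rewrite rnorm_complex -[leRHS]ger0_norm ?addr_ge0 // -sqrtr_sqr ler_sqrt ?sqr_ge0 //.
rewrite sqrrD !real_normK ?num_real // lerD2r lerDl.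
by rewrite mulrn_wge0 // mulr_ge0.
Qed.

(** A filter on T is pushed into the compact image of a square in the plane; its cluster point has
    norm 1 by continuity of the norm, hence comes from T. *)
Lemma circle_compact : compact [set: T].
Proof.
pose g (p : R * R) : C R := (p.1 +i* p.2)%C.
have gc : continuous g.
  move=> p U /nbhs_rnormP[e e0 eU]; rewrite nbhs_simpl /=.
  have e2 : 0 < e / 2 by lra.
  exists (ball p.1 (e / 2), ball p.2 (e / 2)); first by split; exact: nbhsx_ballx.
  move=> [a b] [/= pa pb]; apply: eU; apply: le_lt_trans (rnorm_Re_Im _ _) _.
  by move: pa pb; rewrite -!ball_normE /=; lra.
have gK : compact (g @` ([set` `[-1, 1]%R] `*` [set` `[-1, 1]%R])).
  apply: continuous_compact; first exact: continuous_subspaceT.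
  by apply: compact_setX; exact: segment_compact.
move=> F FF _; have [|z [_ zF]] := gK (set_val @ F) _.
  rewrite fmapE; apply: (@filterS T F _ setT) => [t _|]; last exact: filterT.
  exists (complex.Re (set_val t : C R), complex.Im (set_val t : C R)).
    have := rnorm_circle t; case: (set_val t : C R) => a b.
    rewrite rnorm_complex => ab1; have {}ab1 : a ^+ 2 + b ^+ 2 = 1.
      by rewrite -[LHS]sqr_sqrtr ?addr_ge0 ?sqr_ge0 // ab1 expr1n.
    by split=> /=; rewrite in_itv /=; nra.
  by rewrite /g; case: (set_val t : C R).
have zt (e : R) (P : set T) : 0 < e -> F P -> exists2 t, P t & rnorm (z - set_val t : C R) < e.
  move=> e0 FP; have [||_ [[t Pt <-] tz]] := zF (set_val @` P) [set y | rnorm (z - y) < e].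
  - by rewrite fmapE; apply: (@filterS T F _ _ _ _ FP) => t Pt; exists t.
  - by apply/nbhs_rnormP; exists e.
  by exists t.
have z1 : unit_circle (R := R) z.
  rewrite /unit_circle /= -rnormE; congr RtoC; apply/eqP; rewrite eq_le.
  apply/andP; split; apply/ler_addgt0Pr => e e0;
    have [t _ te] := zt e setT e0 filterT.
    have := rnormD (z - set_val t) (set_val t : C R); rewrite subrK rnorm_circle; lra.
  have := rnormD (set_val t - z : C R) z; rewrite subrK rnorm_circle.
  by move: te; rewrite rnorm_distrC; lra.
exists (exist _ z (mem_set z1)); split => // P Q FP /circle_nbhs[e e0 eQ].
by have [t Pt tz] := zt e P e0 FP; exists t; split=> //; exact: eQ.
Qed.

Section ContinuousFunctions.
Variables (f : T -> C R) (fc : continuous f).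

Lemma nbhs_rnorm_lt x (e : R) : 0 < e -> nbhs x [set t | rnorm (f x - f t) < e].
Proof.
move=> e0; have h : nbhs (f x) [set y | rnorm (f x - y) < e].
  by apply/nbhs_rnormP; exists e.
exact: (fc h).
Qed.

Lemma circle_uniform_continuity (e : R) : 0 < e -> exists2 d : R, 0 < d &
  forall s t, rnorm (set_val s - set_val t : C R) < d -> rnorm (f s - f t) < e.
Proof.
move=> e0; have e2 : 0 < e / 2 by lra.
have /compact_near_coveringP cov := circle_compact.
pose P (d : R) (s : T) :=
  forall t, rnorm (set_val s - set_val t : C R) < d -> rnorm (f s - f t) < e.
have : \forall d \near 0^'+, [set: T] `<=` P d.
  apply: (cov R 0^'+ P) => x _.
  have /circle_nbhs[d d0 dP] : nbhs x [set t | rnorm (f x - f t) < e / 2].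
    exact: nbhs_rnorm_lt.
  have d2 : 0 < d / 2 by lra.
  exists ([set s | rnorm (set_val x - set_val s : C R) < d / 2], [set r | r < d / 2]).
    split; first by apply/circle_nbhs; exists (d / 2).
    exact: nbhs_right_lt.
  move=> [s r] [/= xs rd] t st.
  have xt : rnorm (set_val x - set_val t : C R) < d.
    have := rnormD (set_val x - set_val s : C R) (set_val s - set_val t).
    by rewrite addrA subrK; lra.
  have h1 : rnorm (f x - f s) < e / 2 by apply: dP; lra.
  have h2 : rnorm (f x - f t) < e / 2 by exact: dP.
  have := rnormD (f s - f x) (f x - f t); rewrite addrA subrK rnorm_distrC in h1 *; lra.
move=> Pd; have : \forall d \near (0 : R)^'+, 0 < d /\ [set: T] `<=` P d.
  by near=> d; split; near: d => //; exact: nbhs_right_gt.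
move=> /filter_ex[d [d0 Pd0]]; exists d => // s t; exact: Pd0.
Unshelve. all: by end_near. Qed.

Lemma circle_bounded : exists2 M : R, 0 <= M & forall t, rnorm (f t) <= M.
Proof.
have /compact_near_coveringP cov := circle_compact.
have : \forall M \near (+oo : set_system R), [set: T] `<=` (fun t => rnorm (f t) <= M).
  apply: (cov R (+oo : set_system R) (fun M t => rnorm (f t) <= M)) => x _.
  exists ([set t | rnorm (f x - f t) < 1], [set M | rnorm (f x) + 1 <= M]).
    split; last by apply: nbhs_pinfty_ge; exact: num_real.
    exact: nbhs_rnorm_lt.
  move=> [s r] [/= xs rM].
  have := rnormD (f s - f x) (f x); rewrite subrK rnorm_distrC; lra.
move=> PM; have : \forall M \near (+oo : set_system R),
    0 <= M /\ [set: T] `<=` (fun t => rnorm (f t) <= M).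
  by near=> M; split; near: M => //; by apply: nbhs_pinfty_ge; exact: num_real.
by move=> /filter_ex[M [M0 PM0]]; exists M => // t; exact: PM0.
Unshelve. all: by end_near. Qed.

End ContinuousFunctions.

End CircleTopology.

(** * Density of trigonometric polynomials among continuous functions *)

Section TrigonometricDensity.
Variable R : realType.
Local Notation T := (circle R).
Implicit Types (s t z : C R).

(* For s = e^(ia) and t = e^(ib) this is cos((a - b) / 2)^(2n). *)
Definition cos_kernel n s t : C R := ((s + t) ^+ 2 / (s * t) / 4) ^+ n.

Lemma unit_neq0 s : `|s| = 1 -> s != 0.
Proof. by move=> s1; rewrite -normr_eq0 s1 oner_neq0. Qed.

Lemma unit_conj s : `|s| = 1 -> s^* = s^-1.
Proof.
move=> s1; have s0 := unit_neq0 s1.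
by apply: (mulfI s0); rewrite -normCK s1 expr1n mulfV.
Qed.

(** On the circle |s - t|^2 = 2 - s/t - t/s. In this form the kernel is visibly positive and small
    away from s = t. *)
Lemma cos_kernelE n s t : `|s| = 1 -> `|t| = 1 ->
  cos_kernel n s t = RtoC ((1 - rnorm (s - t) ^+ 2 / 4) ^+ n).
Proof.
move=> s1 t1; have [s0 t0] := (unit_neq0 s1, unit_neq0 t1).
rewrite RtoCX /cos_kernel; congr (_ ^+ n).
have -> : RtoC (1 - rnorm (s - t) ^+ 2 / 4) = 1 - RtoC (rnorm (s - t) ^+ 2) / 4.
  by rewrite /RtoC rmorphB rmorphM rmorph1 fmorphV rmorph_nat.
rewrite RtoCX rnormE normCK rmorphB /= !unit_conj //.
by field; rewrite s0 t0.
Qed.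

(** A trigonometric polynomial of degree n in each variable: sampling in t leaves a trigonometric
    polynomial in s. *)
Lemma cos_kernel_sum n s t : s != 0 -> t != 0 -> cos_kernel n s t =
  \sum_(i < n.*2.+1) ('C(n.*2, i)%:R / 4 ^+ n) * (s ^ (n%:Z - i%:Z) * t ^ (i%:Z - n%:Z)).
Proof.
move=> s0 t0; rewrite /cos_kernel !expr_div_n -exprM mul2n exprDn !mulr_suml.
apply: eq_bigr => i _; have iN : (i <= n.*2)%N by rewrite -ltnS.
have [su tu] : s \is a GRing.unit /\ t \is a GRing.unit by rewrite !unitfE.
have -> : s ^ (n%:Z - i%:Z) = s ^+ (n.*2 - i) / s ^+ n.
  rewrite [RHS]mulrC !exprnP invr_expz -expfzDr //; congr (_ ^ _); lia.
have -> : t ^ (i%:Z - n%:Z) = t ^+ i / t ^+ n.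
  by rewrite expfzDr // -exprz_inv -!exprnP exprVn.
rewrite exprMn -mulr_natl; field.
by rewrite !expf_neq0 //= pnatr_eq0.
Qed.

(** The frequencies i - n lie in [-n, n] and n < m, so averaging over the m-th roots kills all but
    the constant term. *)
Lemma cos_kernel_mean (w : C R) m n s : m.-primitive_root w -> (n < m)%N -> s != 0 ->
  \sum_(j < m) cos_kernel n s (w ^+ j) = m%:R * ('C(n.*2, n)%:R / 4 ^+ n).
Proof.
move=> hw nm s0; have m0 := prim_order_gt0 hw.
have w0 : w != 0 by rewrite (prim_root_eq0 hw) -lt0n.
under eq_bigr do rewrite cos_kernel_sum ?expf_neq0 //.
rewrite exchange_big /=; have nN : (n < n.*2.+1)%N by lia.
rewrite (bigD1 (Ordinal nN)) //= [X in _ + X]big1 ?addr0 => [|i /eqP iN].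
  under eq_bigr do rewrite !subrr !expr0z !mulr1.
  by rewrite sumr_const card_ord -[_ *+ m]mulr_natl.
rewrite -mulr_sumr -mulr_sumr.
under eq_bigr do rewrite exprnP exprzAC -exprnP.
rewrite prim_root_sum //; case: ifPn; rewrite ?mulr0 //.
rewrite dvdzE /= => /dvdn_leq mi; exfalso; apply: iN; apply/val_inj => /=.
have [//|in_] := eqVneq (i : nat) n; exfalso.
have : (0 < `|i%:Z - n%:Z|)%N by rewrite absz_gt0 subr_eq0 eqz_nat.
by move/mi; have := ltn_ord i; lia.
Qed.

(** The central coefficient is the largest of 2n + 1 coefficients with sum 4^n; the induction uses
    the ratio [h] of consecutive central coefficients. So the mean of the kernel decays only
    polynomially, against geometric decay away from s = t. *)
Lemma central_bin_ge n : (4 ^ n <= n.*2.+1 * 'C(n.*2, n))%N.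
Proof.
elim: n => [|n IH]; first by [].
have h : (n.+1 * 'C(n.+1.*2, n.+1) = 2 * n.*2.+1 * 'C(n.*2, n))%N.
  have h1 := mul_bin_diag n.*2.+2 n.
  have h2 := mul_bin_diag n.*2.+1 n.
  have h3 : ('C(n.*2.+1, n) = 'C(n.*2.+1, n.+1))%N.
    by rewrite -bin_sub; [congr 'C(_, _)|]; lia.
  by rewrite doubleS; move: h1 h2; rewrite h3 /=; nia.
by rewrite expnS; nia.
Qed.

(** Each of the n + 1 terms of 1 + r + ... + r^n is at least r^n, and the sum is at most 1 / (1 -
    r). *)
Lemma pow_le_inv (r : R) n : 0 <= r < 1 -> n.+1%:R * r ^+ n * (1 - r) <= 1.
Proof.
move=> /andP[r0 r1].
have h : (n.+1%:R * r ^+ n) * (1 - r) <= (\sum_(i < n.+1) r ^+ i) * (1 - r).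
  rewrite ler_wpM2r ?subr_ge0 ?(ltW r1) //.
  have -> : n.+1%:R * r ^+ n = \sum_(i < n.+1) r ^+ n.
    by rewrite sumr_const card_ord mulr_natl.
  by apply: ler_sum => i _; rewrite ler_wiXn2l // ?ltW // -ltnS.
apply: le_trans h _; rewrite mulrC -opprB mulNr -subrX1 opprB gerBl.
exact: exprn_ge0.
Qed.

(** A discrete convolution: the values of f at the m-th roots of unity, averaged with kernel weights
    normalized to sum 1. Nodes within d' of t contribute at most e / 2 by uniform continuity; at the
    others the kernel is at most r^n2. *)
Lemma trigonometric_density (f : T -> C R) (e : R) : continuous f -> 0 < e ->
  exists N (a : nat -> C R) (l : nat -> int), forall t : T,
    rnorm (f t - \sum_(i < N) a i * phi (l i) t) <= e.
Proof.
move=> fc e0; have e2 : 0 < e / 2 by lra.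
have [d d0 fd] := circle_uniform_continuity fc e2.
have [M M0 fM] := circle_bounded fc.
(* The cap at 1 keeps r in [0, 1). *)
pose d' := Num.min d 1; have d'0 : 0 < d' by rewrite lt_min d0 ltr01.
have d'1 : d' <= 1 by rewrite ge_min lexx orbT.
have d'd : d' <= d by rewrite ge_min lexx.
pose r := 1 - d' ^+ 2 / 4; have r01 : 0 <= r < 1 by rewrite /r; apply/andP; split; nra.
have [r0 r1] := andP r01; have r'0 : 0 < 1 - r by lra.
(* Chosen so that n + 1 > q makes the far contribution, at most 8 M / ((1 - r)^2 (n + 1)), smaller
   than e / 2. *)
pose q := 16 * (M + 1) / ((1 - r) ^+ 2 * e).
pose n := Num.bound q; have qn : q < n.+1%:R.
  apply: lt_trans (_ : n%:R < _); last by rewrite ltr_nat.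
  by apply: archi_boundP; rewrite divr_ge0 ?(mulr_ge0 (sqr_ge0 _) (ltW e0)) //; lra.
(* Doubling splits r^n2 into r^n r^n, each factor being at most 1 / ((1 - r) (n + 1)): one
   compensates 1 / b <= 4 (n + 1), the other gives the decay. *)
pose n2 := n.*2; pose m := n2.+1.
have [w hw] := @prim_root_exists R m isT.
pose b : R := 'C(n2.*2, n2)%:R / 4 ^+ n2.
have b0 : 0 < b.
  apply: divr_gt0; last by rewrite exprn_gt0.
  by rewrite ltr0n bin_gt0 -addnn leq_addr.
have bV : b^-1 <= 4 * n.+1%:R.
  rewrite -[b^-1]mul1r ler_pdivrMr // /b mulrA ler_pdivlMr ?exprn_gt0 // mul1r.
  rewrite -natrX -!natrM ler_nat; apply: leq_trans (central_bin_ge n2) _.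
  by rewrite leq_mul2r; apply/orP; right; rewrite /n2; lia.
have w1 j : `|w ^+ j| = 1.
  by rewrite normrX (norm_unity_root _ (prim_expr_order hw)) ?expr1n.
pose wT j : T := exist _ (w ^+ j) (mem_set (w1 j)).
pose k (t : T) j : R := (1 - rnorm (set_val t - w ^+ j : C R) ^+ 2 / 4) ^+ n2.
have kE (t : T) j : cos_kernel n2 (set_val t) (w ^+ j) = RtoC (k t j).
  by rewrite cos_kernelE // norm_circle.
have ksum (t : T) : \sum_(j < m) k t j = m%:R * b.
  apply: RtoC_inj; rewrite RtoC_sum; under eq_bigr do rewrite -kE.
  rewrite (cos_kernel_mean hw) ?unit_neq0 ?norm_circle // RtoCM RtoC_nat; congr (_ * _).
  by rewrite RtoCM RtoC_nat RtoCV RtoCX RtoC_nat.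
have k0 (t : T) j : 0 <= k t j.
  apply: exprn_ge0; have := rnormD (set_val t : C R) (- w ^+ j).
  rewrite rnormN rnorm_circle; have -> : rnorm (w ^+ j) = 1.
    by apply: RtoC_inj; rewrite rnormE w1.
  have := rnorm_ge0 (set_val t - w ^+ j : C R); nra.
have m0R : (0 : R) < m%:R by rewrite ltr0n.
have mb0 : 0 < m%:R * b by exact: mulr_gt0.
exists n2.*2.+1; exists (fun i => \sum_(j < m) f (wT j) / RtoC (m%:R * b) *
  ('C(n2.*2, i)%:R / 4 ^+ n2) * (w ^+ j) ^ (i%:Z - n2%:Z)).
exists (fun i => n2%:Z - i%:Z) => t.
have -> : \sum_(i < n2.*2.+1) (\sum_(j < m) f (wT j) / RtoC (m%:R * b) *
      ('C(n2.*2, i)%:R / 4 ^+ n2) * (w ^+ j) ^ (i%:Z - n2%:Z)) * phi (n2%:Z - i%:Z) t =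
    \sum_(j < m) RtoC (k t j / (m%:R * b)) * f (wT j).
  under eq_bigr do rewrite mulr_suml; rewrite exchange_big /=; apply: eq_bigr => j _.
  rewrite [RtoC (k t j / _)]RtoCM -kE cos_kernel_sum ?unit_neq0 ?norm_circle // -mulrA mulr_suml.
  apply: eq_bigr => i _; rewrite /phi RtoCV.
  by ring.
have {1}-> : f t = \sum_(j < m) RtoC (k t j / (m%:R * b)) * f t.
  rewrite -mulr_suml -RtoC_sum -mulr_suml ksum mulfV ?mul1r //.
  by rewrite gt_eqF.
rewrite -sumrB; apply: le_trans (rnorm_sum _ _ _) _.
apply: (@le_trans _ _ (\sum_(j < m) (e / 2 * k t j + 2 * M * r ^+ n2) / (m%:R * b))).
  apply: ler_sum => j _; rewrite -mulrBr rnormM rnorm_RtoC ger0_norm; last first.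
    by rewrite divr_ge0 // ltW.
  rewrite mulrAC ler_pM2r ?invr_gt0 //.
  have rn0 : 0 <= r ^+ n2 by exact: exprn_ge0.
  have [near_|far] := ltP (rnorm (set_val t - w ^+ j : C R)) d'.
    rewrite mulrC; apply: ler_wpDr; first by apply: mulr_ge0 => //; exact: mulr_ge0.
    apply: ler_wpM2r => //; by apply/ltW/fd; rewrite /wT /=; exact: lt_le_trans d'd.
  have kr : k t j <= r ^+ n2.
    apply: lerXn2r; rewrite ?nnegrE //; last by rewrite /r; nra.
    have := rnormD (set_val t : C R) (- w ^+ j).
    rewrite rnormN rnorm_circle; have -> : rnorm (w ^+ j) = 1.
      by apply: RtoC_inj; rewrite rnormE w1.
    have := rnorm_ge0 (set_val t - w ^+ j : C R); nra.
  have : rnorm (f t - f (wT j)) <= 2 * M.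
    have := rnormD (f t) (- f (wT j)); rewrite rnormN.
    have := fM t; have := fM (wT j); lra.
  have := rnorm_ge0 (f t - f (wT j)); have := k0 t j; nra.
rewrite -mulr_suml big_split /= -mulr_sumr ksum sumr_const card_ord.
have -> : (e / 2 * (m%:R * b) + 2 * M * r ^+ n2 *+ m) / (m%:R * b) =
    e / 2 + 2 * M * r ^+ n2 / b.
  by rewrite -[_ *+ m]mulr_natl; field; rewrite !gt_eqF.
have p1 := pow_le_inv n r01.
have rn0 : 0 <= r ^+ n by exact: exprn_ge0.
have n0 : (0 : R) < n.+1%:R by rewrite ltr0n.
have h1 : r ^+ n2 / b <= 4 * (n.+1%:R * r ^+ n) * r ^+ n.
  have -> : r ^+ n2 = r ^+ n * r ^+ n by rewrite -exprD addnn.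
  apply: le_trans (_ : r ^+ n * r ^+ n * (4 * n.+1%:R) <= _).
    by rewrite ler_wpM2l ?mulr_ge0.
  by rewrite le_eqVlt; apply/orP; left; apply/eqP; ring.
have h3 : (n.+1%:R * r ^+ n) <= (1 - r)^-1 by rewrite -[leRHS]mul1r ler_pdivlMr.
have h4 : r ^+ n <= (1 - r)^-1 / n.+1%:R by rewrite ler_pdivlMr // mulrC.
have h5 : r ^+ n2 / b <= 4 / ((1 - r) ^+ 2 * n.+1%:R).
  apply: le_trans h1 _; rewrite -mulrA.
  have -> : 4 / ((1 - r) ^+ 2 * n.+1%:R) = 4 * ((1 - r)^-1 * ((1 - r)^-1 / n.+1%:R)).
    by field; rewrite !gt_eqF.
  by rewrite ler_pM2l // ler_pM // mulr_ge0.
have h6 : 16 * (M + 1) / (1 - r) ^+ 2 < n.+1%:R * e.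
  by move: qn; rewrite /q invfM mulrA ltr_pdivrMr.
have h7 : 16 * (M + 1) / ((1 - r) ^+ 2 * n.+1%:R) < e.
  by rewrite invfM mulrA ltr_pdivrMr // [e * _]mulrC.
have g0 : 0 < ((1 - r) ^+ 2 * n.+1%:R)^-1 by rewrite invr_gt0 mulr_gt0 ?exprn_gt0.
have := ler_wpM2l M0 h5; rewrite -[2 * M * _ / b]mulrA -[2 * M * _]mulrA.
move: h7 g0; set Y := (_ * _)^-1; set X := r ^+ n2 / b => h7 g0 h8.
have : 2 * (M * X) <= 8 * (M * Y) by lra.
have : 0 <= M * Y by rewrite mulr_ge0 // ltW.
lra.
Qed.

End TrigonometricDensity.

(** * Regularization of finitely additive set functions *)

Section CompactHausdorff.
Variables (R : realType) (T : topologicalType).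
Hypotheses (hT : hausdorff_space T) (cT : compact [set: T]).
Implicit Types (A B K O : set T).

Lemma bigsetU_open (I : Type) (r : seq I) (O : I -> set T) :
  (forall i, open (O i)) -> open (\big[setU/set0]_(i <- r) O i).
Proof. by move=> oO; elim/big_rec: _ => [|i S _]; [exact: open0|exact: openU]. Qed.

Lemma closed_compactT A : closed A -> compact A.
Proof. by move=> cA; exact: subclosed_compact cA cT _. Qed.

Lemma open_setD O K : open O -> compact K -> open (O `\` K).
Proof. by move=> oO /(compact_closed hT) cK; apply: openI => //; exact: closed_openC. Qed.

Lemma compact_setD K O : compact K -> open O -> compact (K `\` O).
Proof. by move=> cK oO; apply: compact_closedI => //; exact: open_closedC. Qed.

Lemma compact_separation K K' : compact K -> compact K' -> K `&` K' = set0 ->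
  exists U V, [/\ open U, open V, K `<=` U, K' `<=` V & U `&` V = set0].
Proof.
move=> /(compact_closed hT) cK /(compact_closed hT) cK'.
have /(@normal_openP R T) := compact_normal hT cT; exact.
Qed.

Lemma compact_increasing_cover K (O : nat -> set T) : compact K ->
  (forall n, open (O n)) -> {homo O : m n / (m <= n)%N >-> m `<=` n} ->
  K `<=` \bigcup_n O n -> exists N, K `<=` O N.
Proof.
move=> /compact_near_coveringP cK oO mO KO.
have [|N _ KN] := cK nat \oo (fun n t => O n t) _; last first.
  by exists N; exact: KN N (leqnn N).
move=> t /KO[n _ Ont]; exists (O n, [set k | (n <= k)%N]) => /=.
  by split; [exact: (open_nbhs_nbhs (conj (oO n) Ont))|exists n].
by move=> [s k] [/= Ons nk]; exact: mO nk _ Ons.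
Qed.

Definition finitely_additive (L : set T -> R) :=
  (forall A, 0 <= L A) /\
  (forall A B, A `&` B = set0 -> L (A `|` B) = L A + L B).

(** For open O this can be smaller than [L O], when mass of L accumulates at the boundary of O from
    inside. *)
Definition inner_content (L : set T -> R) O :=
  sup [set L K | K in [set K | compact K /\ K `<=` O]].

Definition outer_content (L : set T -> R) B :=
  inf [set inner_content L O | O in [set O | open O /\ B `<=` O]].

(** The gap between O and K is open, so [inner_content] already measures it. *)
Definition regular_for (L : set T -> R) B := forall e, 0 < e -> exists K O,
  [/\ compact K, open O, K `<=` B, B `<=` O & inner_content L (O `\` K) < e].

Section OneContent.
Variables (L : set T -> R) (cL : finitely_additive L).
Local Notation lam := (inner_content L).
Local Notation out := (outer_content L).

Lemma content_ge0 A : 0 <= L A. Proof. exact: cL.1. Qed.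

Lemma content0 : L set0 = 0.
Proof. by have := cL.2 set0 set0 (setI0 _); rewrite setU0; lra. Qed.

Lemma le_content A B : A `<=` B -> L A <= L B.
Proof.
move=> AB; have -> : B = A `|` (B `\` A) by rewrite setUDr setDv setD0 setUidr.
by rewrite cL.2 ?setDIK // lerDl content_ge0.
Qed.

Lemma contentU A B : L (A `|` B) <= L A + L B.
Proof.
have -> : A `|` B = A `|` (B `\` A) by rewrite setDE setUIr setUCr setIT.
by rewrite cL.2 ?setDIK // lerD2l le_content.
Qed.

Lemma inner_has_sup O : has_sup [set L K | K in [set K | compact K /\ K `<=` O]].
Proof.
split; first by exists (L set0), set0 => //=; split=> //; exact: compact0.
by exists (L setT) => _ [K _ <-]; exact: le_content.
Qed.

Lemma inner_ge O K : compact K -> K `<=` O -> L K <= lam O.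
Proof. by move=> cK KO; apply: ub_le_sup; [exact: (inner_has_sup O).2|exists K]. Qed.

Lemma inner_le O c : (forall K, compact K -> K `<=` O -> L K <= c) -> lam O <= c.
Proof.
move=> h; apply: ge_sup; first exact: (inner_has_sup O).1.
by move=> _ [K [cK KO] <-]; exact: h.
Qed.

Lemma inner_ge0 O : 0 <= lam O.
Proof.
rewrite -content0; apply: inner_ge => //; exact: compact0.
Qed.

Lemma le_inner O O' : O `<=` O' -> lam O <= lam O'.
Proof.
move=> OO; apply: inner_le => K cK KO; apply: inner_ge => //.
exact: subset_trans OO.
Qed.

Lemma inner_leT O : lam O <= L setT.
Proof. by apply: inner_le => K _ _; exact: le_content. Qed.

(** For K compact in the union, the parts of K outside O' and outside O are disjoint compacts.
    Disjoint open sets U and V around them cut K into two compacts, K minus V inside O and K minus U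
    inside O'. *)
Lemma innerU O O' : open O -> open O' -> lam (O `|` O') <= lam O + lam O'.
Proof.
move=> oO oO'; apply: inner_le => K cK KO.
have [|U [V [oU oV KU KV UV0]]] :=
    @compact_separation (K `\` O') (K `\` O) (compact_setD cK oO') (compact_setD cK oO).
  by rewrite -subset0 => t [[Kt nO't] [_ nOt]]; have [] := KO t Kt.
have -> : K = (K `\` V) `|` (K `\` U) by rewrite -setDIr setIC UV0 setD0.
apply: le_trans (contentU _ _) _; apply: lerD; apply: inner_ge;
  do ?[exact: compact_setD].
- by move=> t [Kt nVt]; apply: contrapT => nOt; apply: nVt; exact: KV.
- by move=> t [Kt nUt]; apply: contrapT => nOt; apply: nUt; exact: KU.
Qed.

Lemma inner_disjointU O O' : O `&` O' = set0 -> lam O + lam O' <= lam (O `|` O').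
Proof.
move=> OO'; rewrite -lerBrDr; apply: inner_le => K cK KO.
rewrite lerBrDr -lerBrDl; apply: inner_le => K' cK' KO'; rewrite lerBrDl.
rewrite -cL.2; last by apply: subsetI_eq0 OO'.
by apply: inner_ge; [exact: compactU|exact: setUSS].
Qed.

(** If K nearly attains the supremum, a compact in the rest of O is disjoint from K, and additivity
    leaves it at most e. *)
Lemma inner_approx O e : open O -> 0 < e ->
  exists K, [/\ compact K, K `<=` O & lam (O `\` K) <= e].
Proof.
move=> oO e0; have [_ [K [cK KO] <-] LK] := sup_adherent e0 (inner_has_sup O).
exists K; split=> //; apply: inner_le => K' cK' K'O.
have : L K + L K' <= lam O.
  rewrite -cL.2; last first.
    by rewrite -subset0 => t [Kt /K'O[_]].
  apply: inner_ge; first exact: compactU.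
  by rewrite subUset; split=> // t /K'O[].
by move: LK; rewrite -/(lam O); lra.
Qed.

Lemma inner_bigU (I : Type) (r : seq I) (O : I -> set T) : (forall i, open (O i)) ->
  lam (\big[setU/set0]_(i <- r) O i) <= \sum_(i <- r) lam (O i).
Proof.
move=> oO; elim: r => [|i r IH].
  rewrite !big_nil; apply: inner_le => K _; rewrite subset0 => ->.
  by rewrite content0.
rewrite !big_cons; apply: le_trans (innerU _ _) _ => //; last by rewrite lerD2l.
exact: bigsetU_open.
Qed.

Lemma geometric_lt (e : R) N : 0 < e -> \sum_(n < N) e / 2 ^+ n.+1 < e.
Proof.
move=> e0; have -> : \sum_(n < N) e / 2 ^+ n.+1 = e - e / 2 ^+ N.
  elim: N => [|N IH]; first by rewrite big_ord0 expr0 divr1 subrr.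
  rewrite big_ord_recr /= IH exprS; field.
  by rewrite expf_neq0 // pnatr_eq0.
by rewrite ltrBlDr ltrDl divr_gt0 // exprn_gt0.
Qed.

Lemma regular_open O : open O -> regular_for L O.
Proof.
move=> oO e e0; have [|K [cK KO lK]] := @inner_approx O (e / 2) oO; first lra.
by exists K, O; split=> //; apply: le_lt_trans lK _; lra.
Qed.

Lemma regular_setC B : regular_for L B -> regular_for L (~` B).
Proof.
move=> rB e e0; have [K [P [cK oP KB BP lKP]]] := rB e e0; exists (~` P), (~` K); split.
- by apply: closed_compactT; exact: open_closedC.
- by apply: closed_openC; exact: compact_closed.
- exact: subsetC.
- exact: subsetC.
- by rewrite !setDE setCK setIC.
Qed.

(** The union of all the inner compacts need not be compact. A compact K' nearly exhausting the
    union of the outer open sets meets only finitely many of them essentially, and the first N inner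
    compacts then suffice. *)
Lemma regular_bigcup (B : nat -> set T) : (forall n, regular_for L (B n)) ->
  regular_for L (\bigcup_n B n).
Proof.
move=> rB e e0.
have /choice[KO hKO] : forall n, exists KO : set T * set T,
    [/\ compact KO.1, open KO.2, KO.1 `<=` B n, B n `<=` KO.2 &
        lam (KO.2 `\` KO.1) < e / 2 / 2 ^+ n.+1].
  move=> n; have [|K [P h]] := rB n (e / 2 / 2 ^+ n.+1).
    by rewrite !divr_gt0 // exprn_gt0.
  by exists (K, P).
pose O := \bigcup_n (KO n).2.
have oO : open O by apply: bigcup_open => n _; have [] := hKO n.
have [|K' [cK' K'O lK']] := @inner_approx O (e / 2) oO; first lra.
have oN N : open (\big[setU/set0]_(n < N) (KO n).2).
  by apply: (@bigsetU_open _ _ (fun n : 'I_N => (KO n).2)) => n; have [] := hKO n.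
have [|t|N K'N] := compact_increasing_cover cK' oN.
- by move=> m n mn; exact: (@subset_bigsetU _ (fun n => (KO n).2) _ _ mn).
- by move/K'O => [n _ Ont]; exists n.+1 => //; rewrite big_ord_recr; right.
exists (\big[setU/set0]_(n < N) (KO n).1), O; split=> //.
- by apply: bigsetU_compact => n _; have [] := hKO n.
- rewrite -(bigcup_mkord N (fun n => (KO n).1)) => t [n _ Kt]; exists n => //.
  by have [_ _ + _ _] := hKO n; apply.
- by move=> t [n _ Bt]; exists n => //; have [_ _ _ + _] := hKO n; apply.
have dO n : open ((KO n).2 `\` (KO n).1).
  by have [? ? _ _ _] := hKO n; exact: open_setD.
apply: (@le_lt_trans _ _ (lam ((O `\` K') `|`
    \big[setU/set0]_(n < N) ((KO n).2 `\` (KO n).1)))).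
  apply: le_inner => t [Ot nKt].
  have [K't|nK't] := pselect (K' t); last by left.
  right; move: (K'N _ K't) nKt; rewrite -(bigcup_mkord N (fun n => (KO n).1)).
  rewrite -(bigcup_mkord N (fun n => (KO n).2 `\` (KO n).1)).
  rewrite -(bigcup_mkord N (fun n => (KO n).2)) => -[n nN Ont] nKt.
  by exists n => //; split=> // Kt; apply: nKt; exists n.
apply: le_lt_trans (innerU _ _) _.
- exact: open_setD.
- exact: (@bigsetU_open _ _ (fun n : 'I_N => (KO n).2 `\` (KO n).1)).
have : \sum_(n < N) lam ((KO n).2 `\` (KO n).1) < e / 2.
  apply: (@le_lt_trans _ _ (\sum_(n < N) e / 2 / 2 ^+ n.+1)).
    by apply: ler_sum => n _; have [_ _ _ _ /ltW] := hKO n.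
  by apply: geometric_lt; lra.
have := inner_bigU (index_enum 'I_N) (O := fun n : 'I_N => (KO n).2 `\` (KO n).1)
  (fun n => dO n).
lra.
Qed.

Lemma regular_borel B : <<s open >> B -> regular_for L B.
Proof.
apply: smallest_sub; last by move=> O; exact: regular_open.
split.
- by apply: regular_open; exact: open0.
- by move=> A rA; rewrite setTD; exact: regular_setC.
- exact: regular_bigcup.
Qed.

Lemma outer_has_inf B : has_inf [set lam O | O in [set O | open O /\ B `<=` O]].
Proof.
split; first by exists (lam setT), setT => //=; split=> //; exact: openT.
by exists 0 => _ [P _ <-]; exact: inner_ge0.
Qed.

Lemma outer_le B O : open O -> B `<=` O -> out B <= lam O.
Proof. by move=> oO BO; apply: ge_inf; [exact: (outer_has_inf B).2|exists O]. Qed.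

Lemma outer_ge B c : (forall O, open O -> B `<=` O -> c <= lam O) -> c <= out B.
Proof.
move=> h; apply: lb_le_inf; first exact: (outer_has_inf B).1.
by move=> _ [P [oP BP] <-]; exact: h.
Qed.

Lemma outer_adherent B e : 0 < e ->
  exists O, [/\ open O, B `<=` O & lam O < out B + e].
Proof.
by move=> e0; have [_ [P [oP BP] <-] lP] := inf_adherent e0 (outer_has_inf B); exists P.
Qed.

Lemma outer_ge0 B : 0 <= out B.
Proof. by apply: outer_ge => O _ _; exact: inner_ge0. Qed.

Lemma le_outer A B : A `<=` B -> out A <= out B.
Proof.
move=> AB; apply: outer_ge => O oO BO; apply: outer_le => //.
exact: subset_trans BO.
Qed.

Lemma outer_leT B : out B <= L setT.
Proof. by apply: le_trans (outer_le openT _) (inner_leT _). Qed.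

Lemma outerU A B : out (A `|` B) <= out A + out B.
Proof.
apply/ler_addgt0Pr => e e0; have e2 : 0 < e / 2 by lra.
have [P [oP AP lP]] := outer_adherent A e2.
have [P' [oP' BP lP']] := outer_adherent B e2.
have := outer_le (openU oP oP') (setUSS AP BP); have := innerU oP oP'; lra.
Qed.

(** Superadditivity is where regularity enters: nearly full compact subsets of A and B are separated
    by disjoint open sets, and on these [inner_content] is superadditive. *)
Lemma outer_disjointU A B : regular_for L A -> regular_for L B -> A `&` B = set0 ->
  out A + out B <= out (A `|` B).
Proof.
move=> rA rB AB; apply: outer_ge => O oO ABO; apply/ler_addgt0Pr => e e0.
have e2 : 0 < e / 2 by lra.
have [K [P [cK oP KA AP lKP]]] := rA _ e2.
have [K' [P' [cK' oP' KB BP lKP']]] := rB _ e2.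
have [|U [V [oU oV KU KV UV]]] := compact_separation cK cK'.
  exact: subsetI_eq0 AB.
have half (D W J S : set T) : open W -> open S -> compact J -> J `<=` W -> J `<=` D ->
    D `<=` S -> D `<=` O -> lam (S `\` J) < e / 2 -> out D <= lam (W `&` O) + e / 2.
  move=> oW oS cJ JW JD DS DO lSJ.
  have oWO : open (W `&` O) by exact: openI.
  have oSJ : open (S `\` J) by exact: open_setD.
  have := innerU oWO oSJ; have : out D <= lam ((W `&` O) `|` (S `\` J)).
    apply: outer_le; first exact: openU.
    move=> t Dt; have [Jt|nJt] := pselect (J t).
      by left; split; [exact: JW|exact: DO].
    by right; split=> //; exact: DS.
  by lra.
have [AO BO] : A `<=` O /\ B `<=` O by move: ABO; rewrite subUset.
have h1 := half A U K P oU oP cK KU KA AP AO lKP.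
have h2 := half B V K' P' oV oP' cK' KV KB BP BO lKP'.
have h3 : lam (U `&` O) + lam (V `&` O) <= lam ((U `&` O) `|` (V `&` O)).
  by apply: inner_disjointU; rewrite setIACA UV set0I.
have h4 : lam ((U `&` O) `|` (V `&` O)) <= lam O.
  by apply: le_inner; rewrite subUset; split=> t [].
lra.
Qed.

Lemma outer_partition n (A : 'I_n -> set T) : (forall i, regular_for L (A i)) ->
  trivIset setT A -> \sum_(i < n) out (A i) <= out (\bigcup_i A i).
Proof.
elim: n A => [|n IH] A rA tA; first by rewrite big_ord0 outer_ge0.
rewrite big_ord_recl; set B := \bigcup_i A (lift ord0 i).
have rB : regular_for L B.
  (* A finite union written as a countable one, padded with empty sets, so that [regular_bigcup]
     applies. *)
  have -> : B = \bigcup_k (if insub k is Some i then A (lift ord0 i) else set0).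
    rewrite eqEsubset; split=> t.
      by move=> [i _ At]; exists (val i) => //; rewrite valK.
    by move=> [k _]; case: insubP => // i _ _ At; exists i.
  apply: regular_bigcup => k; case: insubP => // _; apply: regular_open; exact: open0.
apply: (@le_trans _ _ (out (A ord0) + out B)).
  rewrite lerD2l; apply: IH => [i|]; first exact: rA.
  move=> i j _ _ [t [Ait Ajt]]; apply: (@lift_inj _ ord0).
  by apply: tA => //; exists t.
apply: le_trans (outer_disjointU _ _ _) _ => //.
  rewrite -subset0 => t [A0t [i _ Ait]].
  by have /eqP := tA ord0 (lift ord0 i) I I (ex_intro _ t (conj A0t Ait));
    rewrite (negPf (neq_lift _ _)).
by apply: le_outer => t [A0t|[i _ Ait]]; [exists ord0|exists (lift ord0 i)].
Qed.

(** Countable additivity comes from compactness: the inner compacts of the B n have empty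
    intersection, so finitely many complements cover T, and from then on B n lies in the finite
    union of the small gaps. *)
Lemma outer_decreasing (B : nat -> set T) : (forall n, regular_for L (B n)) ->
  {homo B : m n / (m <= n)%N >-> n `<=` m} -> \bigcap_n B n = set0 ->
  forall e, 0 < e -> exists N, forall n, (N <= n)%N -> out (B n) < e.
Proof.
move=> rB dB B0 e e0.
have /choice[KO hKO] : forall n, exists KO : set T * set T,
    [/\ compact KO.1, open KO.2, KO.1 `<=` B n, B n `<=` KO.2 &
        lam (KO.2 `\` KO.1) < e / 2 ^+ n.+1].
  move=> n; have [|K [P h]] := rB n (e / 2 ^+ n.+1); last by exists (K, P).
  by rewrite !divr_gt0 // exprn_gt0.
have oC n : open (~` (KO n).1).
  by have [cK _ _ _ _] := hKO n; apply: closed_openC; exact: compact_closed.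
have [||t _|N KN] := 
    compact_increasing_cover (O := fun N => \big[setU/set0]_(n < N) ~` (KO n).1) cT.
- by move=> n; apply: (@bigsetU_open _ _ (fun n : 'I__ => ~` (KO n).1)).
- by move=> m n mn; exact: (@subset_bigsetU _ (fun n => ~` (KO n).1) _ _ mn).
- apply: contrapT => nt.
  suff : set0 t by [].
  rewrite -B0 => n _; have [_ _ + _ _] := hKO n; apply; apply: contrapT => nKt.
  by apply: nt; exists n.+1 => //; rewrite big_ord_recr; right.
exists N => n Nn.
have dO k : open ((KO k).2 `\` (KO k).1).
  by have [? ? _ _ _] := hKO k; exact: open_setD.
apply: (@le_lt_trans _ _ (lam (\big[setU/set0]_(k < N) ((KO k).2 `\` (KO k).1)))).
  apply: outer_le; first exact: (@bigsetU_open _ _ (fun n : 'I_N => (KO n).2 `\` (KO n).1)).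
  move=> t Bt; have := KN t I; rewrite -(bigcup_mkord N (fun n => ~` (KO n).1)).
  rewrite -(bigcup_mkord N (fun n => (KO n).2 `\` (KO n).1)) => -[k /= kN nKt].
  exists k => //; split=> //; have [_ _ _ + _] := hKO k; apply.
  by apply: dB Bt; exact: leq_trans (ltnW kN) Nn.
apply: le_lt_trans (inner_bigU _ (O := fun n : 'I_N => (KO n).2 `\` (KO n).1) (fun n => dO n)) _.
apply: le_lt_trans (geometric_lt N e0).
by apply: ler_sum => k _; have [_ _ _ _ /ltW] := hKO k.
Qed.

End OneContent.
End CompactHausdorff.

(** * The limit functional *)

Section Sequences.
Variable R : realType.

Lemma cvgn_rnormP (V : normedModType (C R)) (u : nat -> V) (l : V) :
  (u n @[n --> \oo] --> l) <->
  forall e : R, 0 < e -> exists N, forall n, (N <= n)%N -> rnorm (l - u n) < e.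
Proof.
split=> [ul e e0|h U /nbhs_rnormP[e e0 eU]].
  have [|N _ NP] := ul [set y | rnorm (l - y) < e] _; last by exists N => n; exact: NP.
  by apply/nbhs_rnormP; exists e.
by have [N NP] := h e e0; exists N => // n /NP; exact: eU.
Qed.

Lemma cauchy_rnorm (V : completeNormedModType (C R)) (u : nat -> V) :
  (forall e : R, 0 < e -> exists N, forall m n, (N <= m)%N -> (N <= n)%N ->
    rnorm (u m - u n) < e) -> cvg (u n @[n --> \oo]).
Proof.
move=> h; apply/cauchy_cvgP/cauchy_ballP => e e0.
have eE : RtoC (complex.Re e) = e by apply/RRe_real/gtr0_real.
have [|N NP] := h (complex.Re e); first by move: e0; rewrite -{1}eE (ltcR 0).
exists (u @` [set n | (N <= n)%N], u @` [set n | (N <= n)%N]) => /=.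
  by split; exists N => // n Nn; exists n.
move=> [_ _] [/= [a Na <-] [b Nb <-]].
by rewrite -eE ball_rnorm; exact: NP.
Qed.

Lemma cvgn_rnorm_unique (V : normedModType (C R)) (u : nat -> V) (l l' : V) :
  u n @[n --> \oo] --> l -> u n @[n --> \oo] --> l' -> l = l'.
Proof. by move=> ul ul'; apply: cvg_unique ul ul'; exact: norm_hausdorff. Qed.

Lemma bounded_ultra_cvg (U : set_system nat) (u : nat -> R) (M : R) :
  UltraFilter U -> (forall n, `|u n| <= M) -> cvg (u n @[n --> U]).
Proof.
move=> UU uM; have [|p [_ up]] := @segment_compact R (- M) M (u @ U) _.
  rewrite fmapE; apply: (@filterS _ U _ setT) => [n _|]; last exact: filterT.
  by rewrite /= in_itv /= -ler_norml.
apply/cvg_ex; exists p => V pV; have [//|nV] := in_ultra_setVsetC (u @^-1` V) UU.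
by have [x []] := up (~` V) V nV pV.
Qed.

End Sequences.

Lemma sum_lt_nat N k0 : (\sum_(k < N) (k < k0) = minn N k0)%N.
Proof. by elim: N => [|N IH]; rewrite ?big_ord0 ?min0n // big_ord_recr /= IH; lia. Qed.

Lemma sum_ge_nat N k0 : (\sum_(k < N) (k0 <= k) = N - k0)%N.
Proof. by elim: N => [|N IH]; rewrite ?big_ord0 // big_ord_recr /= IH; lia. Qed.

(** * Discrete measures at roots of unity *)

Section DiscreteIntegral.
Variables (R : realType) (H : completeNormedModType (C R)).
Variables (dot : {dot H for Num.conj}) (dotE : forall x : H, dot x x = `|x| ^+ 2).
Variables (A : op_matrix H) (At : toeplitz A).
Variables (c : R) (c0 : 0 <= c) (Ac : block_multiplier A c).
Variables (w : nat -> C R) (hw : forall n, (n.+1.*2).-primitive_root (w n)).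
Local Notation T := (circle R).
Implicit Types (f g : T -> C R) (x y : H).

Lemma node_subproof n j : w n ^+ j \in @unit_circle R.
Proof.
apply: mem_set; rewrite /unit_circle /= normrX.
by rewrite (norm_unity_root _ (prim_expr_order (hw n))) ?expr1n.
Qed.

Definition node n j : T := exist _ (w n ^+ j) (node_subproof n j).

(** The number of nodes times the factor n + 1 that turns [fejer] into a mean. *)
Definition weight n : R := (n.+1.*2 * n.+1)%:R.

Lemma weight_gt0 n : 0 < weight n. Proof. by rewrite ltr0n muln_gt0. Qed.

(* Sampling at the 2(n+1)-th roots of unity integrates exactly the trigonometric
   polynomials of degree at most n against the (n+1)-th Fejer mean. *)
Definition discrete_int n f x : H :=
  \sum_(j < n.+1.*2) (f (node n j) / RtoC (weight n)) *: fejer A n.+1 (w n ^+ j) x.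

Definition discrete_var n x (S : set T) : R :=
  \sum_(j < n.+1.*2 | node n j \in S) rnorm (fejer A n.+1 (w n ^+ j) x) / weight n.

Lemma discrete_intD n f g x :
  discrete_int n (fun t => f t + g t) x = discrete_int n f x + discrete_int n g x.
Proof.
rewrite /discrete_int -big_split /=; apply: eq_bigr => j _.
by rewrite mulrDl scalerDl.
Qed.

Lemma discrete_intZ n a f x :
  discrete_int n (fun t => a * f t) x = a *: discrete_int n f x.
Proof.
rewrite /discrete_int scaler_sumr; apply: eq_bigr => j _.
by rewrite scalerA mulrA.
Qed.

Lemma discrete_int_linear n f a x y :
  discrete_int n f (a *: x + y) = a *: discrete_int n f x + discrete_int n f y.
Proof.
rewrite /discrete_int scaler_sumr -big_split /=; apply: eq_bigr => j _.
by rewrite linearP scalerDr !scalerA mulrC.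
Qed.

Lemma discrete_var_ge0 n x S : 0 <= discrete_var n x S.
Proof. by apply: sumr_ge0 => j _; rewrite divr_ge0 ?rnorm_ge0 // ltW ?weight_gt0. Qed.

Lemma discrete_varT n x : discrete_var n x setT <= c * rnorm x.
Proof.
rewrite /discrete_var (eq_bigl xpredT) => [|j]; last by rewrite in_setT.
rewrite -mulr_suml ler_pdivrMr ?weight_gt0 //.
apply: le_trans (fejer_bound dotE c0 Ac x (hw n) _) _; first by lia.
by rewrite /weight natrM mulrA mulrC.
Qed.

Lemma discrete_var_disjointU n x S S' : S `&` S' = set0 ->
  discrete_var n x (S `|` S') = discrete_var n x S + discrete_var n x S'.
Proof.
move=> SS'; rewrite /discrete_var big_mkcond [X in _ = X + _]big_mkcond.
rewrite [X in _ = _ + X]big_mkcond -big_split /=.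
apply: eq_bigr => j _; rewrite in_setU.
case: (boolP (node n j \in S)) => [jS|_] /=; last by rewrite add0r.
rewrite ifF ?addr0 //; apply/negP => jS'.
by have : (S `&` S') (node n j); [split; exact: set_mem|rewrite SS'].
Qed.

Lemma discrete_var_scale n a x S : discrete_var n (a *: x) S = rnorm a * discrete_var n x S.
Proof.
rewrite /discrete_var mulr_sumr; apply: eq_bigr => j _.
by rewrite linearZ /= rnormZ mulrA.
Qed.

Lemma discrete_var_add n x y S :
  discrete_var n (x + y) S <= discrete_var n x S + discrete_var n y S.
Proof.
rewrite /discrete_var -big_split /=; apply: ler_sum => j _.
rewrite -mulrDl ler_wpM2r ?invr_ge0 ?(ltW (weight_gt0 n)) //.
by rewrite linearD rnormD.
Qed.

Lemma le_discrete_var n x S S' : S `<=` S' -> discrete_var n x S <= discrete_var n x S'.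
Proof.
move=> SS; rewrite -(setDUK SS) discrete_var_disjointU ?setDIK //.
by rewrite lerDl discrete_var_ge0.
Qed.

Lemma discrete_int_le n f x (M e : R) (S : set T) : 0 <= M -> 0 <= e ->
  (forall t, rnorm (f t) <= M) -> (forall t, ~ S t -> rnorm (f t) <= e) ->
  rnorm (discrete_int n f x) <= M * discrete_var n x S + e * (c * rnorm x).
Proof.
move=> M0 e0 fM fe; apply: le_trans (rnorm_sum _ _ _) _.
apply: (@le_trans _ _ (M * discrete_var n x S + e * discrete_var n x setT)); last first.
  by rewrite lerD2l ler_wpM2l // discrete_varT.
rewrite /discrete_var !mulr_sumr [X in X + _]big_mkcond [X in _ + X]big_mkcond -big_split /=.
apply: ler_sum => j _; rewrite rnormZ rnormM rnormV rnorm_RtoC ger0_norm ?(ltW (weight_gt0 n)) //.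
rewrite in_setT -mulrA [_^-1 * _]mulrC.
set r := _ / _; have r0 : 0 <= r by rewrite divr_ge0 ?rnorm_ge0 // ltW ?weight_gt0.
case: ifPn => [_|jS]; last first.
  by rewrite add0r ler_wpM2r // fe //; move: jS; rewrite notin_setE.
by apply: ler_wpDr; [exact: mulr_ge0|exact: ler_wpM2r].
Qed.

Lemma discrete_int_phiE n (l : int) x :
  discrete_int n (phi l) x = n.+1%:R^-1 *: \sum_(k < n.+1) \sum_(j < n.+1)
    (if (n.+1.*2%:Z %| l + k%:Z - j%:Z)%Z then A k j x else 0).
Proof.
have w0 : w n != 0 by rewrite (prim_root_eq0 (hw n)).
have wu : w n \is a GRing.unit by rewrite unitfE.
rewrite /discrete_int; under eq_bigr do rewrite fejerE scaler_sumr.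
rewrite exchange_big scaler_sumr /=; apply: eq_bigr => k _.
under eq_bigr do rewrite scaler_sumr.
rewrite exchange_big scaler_sumr /=; apply: eq_bigr => j _.
under eq_bigr do rewrite scalerA.
rewrite -scaler_suml.
have -> : \sum_(i < n.+1.*2) phi l (node n i) / RtoC (weight n) *
      ((w n ^+ i) ^+ k / (w n ^+ i) ^+ j) =
    \sum_(i < n.+1.*2) (w n ^ (l + k%:Z - j%:Z)) ^+ i / RtoC (weight n).
  apply: eq_bigr => i _; rewrite /phi /=.
  have -> : (w n ^ (l + k%:Z - j%:Z)) ^+ i = (w n ^+ i) ^ l * (w n ^+ i) ^+ k / (w n ^+ i) ^+ j.
    rewrite exprnP exprzAC -exprnP !expfzDr ?expf_neq0 // -invr_expz -!exprnP.
    by [].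
  by ring.
rewrite -mulr_suml prim_root_sum //; case: ifP => _; last by rewrite mul0r !scale0r scaler0.
congr (_ *: _); by rewrite RtoC_nat natrM invfM mulrA mulfV ?mul1r.
Qed.

(** For n >= k0 + j0 the exponents stay below 2(n + 1) in absolute value, so there is no aliasing
    and only the diagonal of [A k0 j0] survives. Its entries are equal and present in all but at
    most k0 + j0 of the n + 1 rows: the error is O(1/n). *)
Lemma discrete_int_phi k0 j0 x :
  discrete_int n (phi (j0%:Z - k0%:Z)) x @[n --> \oo] --> A k0 j0 x.
Proof.
apply/cvgn_rnormP => e e0; pose K := (k0 + j0)%N; set v := A k0 j0 x.
suff h n : (K <= n)%N ->
    rnorm (v - discrete_int n (phi (j0%:Z - k0%:Z)) x) <= n.+1%:R^-1 * (K%:R * rnorm v).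
  pose q := K%:R * rnorm v / e.
  have q0 : 0 <= q by rewrite divr_ge0 ?mulr_ge0 ?rnorm_ge0 // ltW.
  exists (K + Num.bound q)%N => n Kn.
  have n0 : (0 : R) < n.+1%:R by rewrite ltr0n.
  apply: le_lt_trans (h n (leq_trans (leq_addr _ _) Kn)) _.
  rewrite ltr_pdivrMl // -ltr_pdivrMr //; apply: lt_le_trans (archi_boundP q0) _.
  by rewrite ler_nat; apply: leq_trans (leqnSn _); apply: leq_trans Kn; exact: leq_addl.
move=> Kn; have n0 : n.+1%:R != 0 :> C R by rewrite pnatr_eq0.
rewrite discrete_int_phiE.
have vE : v = n.+1%:R^-1 *: \sum_(k < n.+1) v.
  by rewrite sumr_const card_ord -[v *+ _]scaler_nat scalerA mulVf // scale1r.
rewrite [X in X - _]vE -scalerBr rnormZ rnormV rnorm_nat ler_wpM2l ?invr_ge0 //.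
rewrite -sumrB; apply: le_trans (rnorm_sum _ _ _) _.
have gE (k : 'I_n.+1) : \sum_(j < n.+1)
    (if (n.+1.*2%:Z %| j0%:Z - k0%:Z + k%:Z - j%:Z)%Z then A k j x else 0) =
    if (k0 <= k + j0 < n.+1 + k0)%N then v else 0.
  have dE (j : 'I_n.+1) : (n.+1.*2%:Z %| j0%:Z - k0%:Z + k%:Z - j%:Z)%Z = (j + k0 == k + j0)%N.
    apply/idP/eqP => [|jk]; last first.
      have -> : j0%:Z - k0%:Z + k%:Z - j%:Z = 0 by lia.
      by rewrite dvdz0.
    rewrite dvdzE /= => /dvdn_leq dl.
    have [d0|d0] := posnP (absz (j0%:Z - k0%:Z + k%:Z - j%:Z)%R); first lia.
    by have := dl d0; have := ltn_ord j; have := ltn_ord k; rewrite /K in Kn; lia.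
  under eq_bigr do rewrite dE.
  case: ifPn => [/andP[h1 h2]|h].
    have jn : (k + j0 - k0 < n.+1)%N by lia.
    rewrite (bigD1 (Ordinal jn)) //= subnK // eqxx big1 ?addr0 => [|j /eqP jN].
      by rewrite /v; congr (bop_fun _ x); apply: At; rewrite /=; lia.
    by case: ifP => // /eqP jk; exfalso; apply: jN; apply/val_inj => /=; lia.
  rewrite big1 // => j _; case: ifP => // /eqP jk; exfalso; move/negP: h; apply.
  by have := ltn_ord j; lia.
(* A row without an entry on this diagonal is among the first k0 or the last j0. *)
apply: (@le_trans _ _ (\sum_(k < n.+1) ((k < k0) + (n.+1 - j0 <= k))%N%:R * rnorm v)).
  apply: ler_sum => k _; rewrite gE; case: ifPn => [_|kN].
    by rewrite subrr rnorm0 mulr_ge0 ?rnorm_ge0.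
  rewrite subr0 -[leLHS]mul1r ler_wpM2r ?rnorm_ge0 // ler1n.
  by have := ltn_ord k; lia.
rewrite -mulr_suml ler_wpM2r ?rnorm_ge0 // -natr_sum ler_nat big_split /=.
by rewrite sum_lt_nat sum_ge_nat /K; lia.
Qed.

End DiscreteIntegral.

(** * Limits of the discrete integrals and of their variations *)

Section LimitFunctional.
Variables (R : realType) (H : completeNormedModType (C R)).
Variables (dot : {dot H for Num.conj}) (dotE : forall x : H, dot x x = `|x| ^+ 2).
Variables (A : op_matrix H) (At : toeplitz A).
Variables (c : R) (c0 : 0 <= c) (Ac : block_multiplier A c).
Variables (w : nat -> C R) (hw : forall n, (n.+1.*2).-primitive_root (w n)).
Variables (U : set_system nat) (UU : UltraFilter U) (Uoo : \oo `<=` U).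
Local Notation T := (circle R).
Local Notation dint := (discrete_int A hw).
Local Notation dvar := (discrete_var A hw).
Implicit Types (f g : T -> C R) (x y : H).

Lemma discrete_int_sup n f x (e : R) : (forall t, rnorm (f t) <= e) ->
  rnorm (dint n f x) <= e * (c * rnorm x).
Proof.
move=> fe; have e0 : 0 <= e by apply: le_trans (fe (node hw n 0)); exact: rnorm_ge0.
have := discrete_int_le dotE c0 Ac hw n x (S := set0) e0 e0 fe (fun t _ => fe t).
by rewrite {1}/discrete_var big_pred0 ?mulr0 ?add0r // => j; rewrite in_set0.
Qed.

Definition limit_int f x : H := lim (dint n f x @[n --> \oo]).

Lemma discrete_int_sum n N (a : nat -> C R) (g : nat -> T -> C R) x :
  dint n (fun t => \sum_(i < N) a i * g i t) x = \sum_(i < N) a i *: dint n (g i) x.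
Proof.
rewrite /discrete_int; under [RHS]eq_bigr do rewrite scaler_sumr.
rewrite exchange_big /=; apply: eq_bigr => j _; rewrite mulr_suml scaler_suml.
by apply: eq_bigr => i _; rewrite scalerA mulrA.
Qed.

Lemma is_cvgn_sum N (F : nat -> nat -> H) :
  (forall i, cvg (F i n @[n --> \oo])) -> cvg (\sum_(i < N) F i n @[n --> \oo]).
Proof.
move=> Fc; elim: N => [|N IH].
  by under eq_fun do rewrite big_ord0; exact: is_cvg_cst.
by under eq_fun do rewrite big_ord_recr /=; exact: is_cvgD.
Qed.

Lemma limit_int_cvg f x : continuous f -> dint n f x @[n --> \oo] --> limit_int f x.
Proof.
move=> fc; suff : cvg (dint n f x @[n --> \oo]) by [].
apply: cauchy_rnorm => e e0.
pose K := c * rnorm x; have K0 : 0 <= K by rewrite mulr_ge0 ?rnorm_ge0.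
pose d := e / (4 * (K + 1)); have d0 : 0 < d by rewrite divr_gt0 // mulr_gt0 //; lra.
have dK : d * K <= e / 4.
  have -> : e / 4 = d * (K + 1) by rewrite /d; field; lra.
  by rewrite ler_pM2l //; lra.
have [N [a [l fl]]] := trigonometric_density fc d0.
pose p (t : T) := \sum_(i < N) a i * phi (l i) t.
have pcvg : cvg (dint n p x @[n --> \oo]).
  rewrite /p; under eq_fun do rewrite (discrete_int_sum _ _ a (fun i => phi (l i))).
  apply: (@is_cvgn_sum N (fun i n => a i *: dint n (phi (l i)) x)) => i.
  apply: is_cvgZl_tmp.
  (* Nonnegative frequencies are read from row 0 of A, negative ones from column 0. *)
  case: (l i) => k; apply/cvg_ex.
    by exists (A 0%N k x); rewrite -[Posz k]subr0; exact: discrete_int_phi.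
  by exists (A k.+1 0%N x); rewrite NegzE -[- _]add0r; exact: discrete_int_phi.
have [|N0 NP] := (cvgn_rnormP _ _).1 pcvg (e / 4); first lra.
exists N0 => m n Nm Nn.
have fp k : rnorm (dint k f x - dint k p x) <= e / 4.
  have -> : dint k f x - dint k p x = dint k (fun t => f t - p t) x.
    rewrite -scaleN1r -discrete_intZ -discrete_intD; congr (dint k _ x).
    by apply/funext => t; rewrite mulN1r.
  by apply: le_trans dK; exact: discrete_int_sup.
have := fp m; have := fp n; have := NP m Nm; have := NP n Nn.
set q := lim _; move=> h1 h2 h3 h4.
have -> : dint m f x - dint n f x = (dint m f x - dint m p x) +
    ((dint m p x - q) + ((q - dint n p x) + (dint n p x - dint n f x))).
  by rewrite !subrKA.
move: h2 h3; rewrite rnorm_distrC => h2; rewrite rnorm_distrC => h3.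
apply: le_lt_trans (rnormD _ _) _.
have := rnormD (dint m p x - q) ((q - dint n p x) + (dint n p x - dint n f x)).
have := rnormD (q - dint n p x) (dint n p x - dint n f x).
lra.
Qed.

Lemma limit_intD f g x : continuous f -> continuous g ->
  continuous (fun t => f t + g t) ->
  limit_int (fun t => f t + g t) x = limit_int f x + limit_int g x.
Proof.
move=> fc gc fgc; apply: cvgn_rnorm_unique (limit_int_cvg fgc) _.
under eq_fun do rewrite discrete_intD.
by apply: cvgD; exact: limit_int_cvg.
Qed.

Lemma limit_intZ a f x : continuous f -> continuous (fun t => a * f t) ->
  limit_int (fun t => a * f t) x = a *: limit_int f x.
Proof.
move=> fc afc; apply: cvgn_rnorm_unique (limit_int_cvg afc) _.
under eq_fun do rewrite discrete_intZ.
by apply: cvgZl_tmp; exact: limit_int_cvg.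
Qed.

Lemma limit_int_linear f a x y : continuous f ->
  limit_int f (a *: x + y) = a *: limit_int f x + limit_int f y.
Proof.
move=> fc; apply: cvgn_rnorm_unique (limit_int_cvg fc) _.
under eq_fun do rewrite discrete_int_linear.
by apply: cvgD; [apply: cvgZl_tmp|]; exact: limit_int_cvg.
Qed.

Lemma limit_int_phi k j x : continuous (phi (R := R) (j%:Z - k%:Z)) ->
  limit_int (phi (j%:Z - k%:Z)) x = A k j x.
Proof.
move=> pc; apply: cvgn_rnorm_unique (limit_int_cvg pc) _.
exact: discrete_int_phi.
Qed.

(* The ultrafilter makes this limit additive in S and a seminorm in x. *)
Definition limit_var x (S : set T) : R := lim (dvar n x S @[n --> U]).

Lemma discrete_var_bounded n x S : `|dvar n x S| <= c * rnorm x.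
Proof.
rewrite ger0_norm ?discrete_var_ge0 //.
by apply: le_trans (le_discrete_var A hw n x (@subsetT _ S)) _; exact: discrete_varT.
Qed.

Lemma limit_var_cvg x S : dvar n x S @[n --> U] --> limit_var x S.
Proof.
have : cvg (dvar n x S @[n --> U]).
  by apply: bounded_ultra_cvg => n; exact: discrete_var_bounded.
by [].
Qed.

Lemma limit_varE x S (l : R) : dvar n x S @[n --> U] --> l -> limit_var x S = l.
Proof. exact: cvg_lim. Qed.

Lemma limit_var_content x : finitely_additive (limit_var x).
Proof.
split=> [S|S S' SS'].
  by apply: limr_ge; [exact: limit_var_cvg|apply: nearW => n; exact: discrete_var_ge0].
apply: limit_varE; under eq_fun do rewrite discrete_var_disjointU //.
by apply: cvgD; exact: limit_var_cvg.
Qed.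

Lemma limit_var_scale a x S : limit_var (a *: x) S = rnorm a * limit_var x S.
Proof.
apply: limit_varE; under eq_fun do rewrite discrete_var_scale.
by apply: cvgM; [exact: cvg_cst|exact: limit_var_cvg].
Qed.

Lemma limit_var_near x S (e : R) : 0 < e ->
  U [set n | `|limit_var x S - dvar n x S| < e].
Proof. by move=> e0; have /cvgrPdist_lt := limit_var_cvg (x := x) (S := S); apply. Qed.

Lemma limit_var_add x y S : limit_var (x + y) S <= limit_var x S + limit_var y S.
Proof.
apply/ler_addgt0Pr => e e0; have e3 : 0 < e / 3 by lra.
have [n /= [h1 [h2 h3]]] := filter_ex (@filterI _ U _ _ _ (limit_var_near (x + y) S e3)
  (@filterI _ U _ _ _ (limit_var_near x S e3) (limit_var_near y S e3))).
move: h1 h2 h3; rewrite !ltr_norml => /andP[? ?] /andP[? ?] /andP[? ?].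
have := discrete_var_add A hw n x y S; lra.
Qed.

Lemma limit_varT x (d : R) : 0 <= d -> block_multiplier A d ->
  limit_var x setT <= d * rnorm x.
Proof.
move=> d0 Ad; apply: limr_le; first exact: limit_var_cvg.
by apply: nearW => n; exact: discrete_varT.
Qed.

(** The set where |f| is at least slightly more than e is compact and inside G, which is why
    [inner_content] suffices instead of [limit_var x G]. The discrete estimate is used at one index
    good for both limits; it exists because U refines the filter at infinity. *)
Lemma limit_int_le f x (M e : R) (G : set T) : continuous f -> 0 <= M -> 0 <= e ->
  open G -> (forall t, rnorm (f t) <= M) -> (forall t, ~ G t -> rnorm (f t) <= e) ->
  rnorm (limit_int f x) <= M * inner_content (limit_var x) G + e * (c * rnorm x).
Proof.
move=> fc M0 e0 oG fM fe; set K := c * rnorm x.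
have K0 : 0 <= K by rewrite mulr_ge0 ?rnorm_ge0.
apply/ler_addgt0Pr => d d0; pose d1 := d / (2 + M + K).
have d10 : 0 < d1 by rewrite divr_gt0 //; lra.
have dE : d = 2 * d1 + M * d1 + K * d1 by rewrite /d1; field; lra.
pose S := [set t | e + d1 <= rnorm (f t)].
have cS : compact S.
  apply: closed_compactT; first exact: circle_compact.
  rewrite -[S]setCK; apply: open_closedC; rewrite openE => t /= /negP.
  rewrite -ltNge => ft; have := nbhs_rnorm_lt fc t (e := e + d1 - rnorm (f t)).
  rewrite subr_gt0 => /(_ ft); apply: filterS => s /= fs /=; apply/negP.
  have := rnormD (f s - f t) (f t); rewrite subrK rnorm_distrC; lra.
have SG : S `<=` G.
  move=> t St; apply: contrapT => /fe; move: St; rewrite /S /=; lra.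
have LS := inner_ge (limit_var_content x) cS SG.
have h1 : U [set n | rnorm (limit_int f x - dint n f x) < d1].
  apply: Uoo; have [N NP] := (cvgn_rnormP _ _).1 (limit_int_cvg (x := x) fc) d1 d10.
  by exists N.
have [n /= [h2 h3]] := filter_ex (@filterI _ U _ _ _ h1 (limit_var_near x S d10)).
have := discrete_int_le dotE c0 Ac hw n x (S := S) M0 (addr_ge0 e0 (ltW d10)) fM.
have fS t : ~ S t -> rnorm (f t) <= e + d1 by rewrite /S /= => /negP; rewrite -ltNge => /ltW.
move=> /(_ fS); rewrite -/K => h4.
move: h3; rewrite ltr_norml => /andP[? ?].
have h5 := rnormD (limit_int f x - dint n f x) (dint n f x); rewrite subrK in h5.
have h6 : dvar n x S <= inner_content (limit_var x) G + d1 by lra.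
have h7 := ler_wpM2l M0 h6.
nra.
Qed.

End LimitFunctional.

(** * Borel sets and functions on the circle *)

Lemma small_inv (R : realType) (e : R) : 0 < e ->
  exists N, forall n, (N <= n)%N -> (n.+1%:R : R)^-1 < e.
Proof.
move=> e0; exists (Num.bound e^-1) => n Nn; rewrite invf_plt ?posrE ?ltr0n //.
apply: lt_le_trans (archi_boundP _) _; first by rewrite invr_ge0 ltW.
by rewrite ler_nat (leq_trans Nn).
Qed.

Section BorelSets.
Variable R : realType.
Local Notation T := (circle R).
Implicit Types (A B O K : set T).

Lemma borel_open O : open O -> borel O.
Proof. by move=> oO; exact: sub_gen_smallest. Qed.

Lemma borelC A : borel A -> borel (~` A).
Proof.
by move=> bA; rewrite -setTD; case: (smallest_sigma_algebra setT (@open T)) => _ + _; apply.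
Qed.

Lemma borel_bigcup (A : nat -> set T) : (forall n, borel (A n)) -> borel (\bigcup_n A n).
Proof. by move=> bA; case: (smallest_sigma_algebra setT (@open T)) => _ _; apply. Qed.

Lemma borelU A B : borel A -> borel B -> borel (A `|` B).
Proof.
move=> bA bB; rewrite -bigcup2E; apply: borel_bigcup => -[|[|n]] //=.
by apply: borel_open; exact: open0.
Qed.

Lemma borelI A B : borel A -> borel B -> borel (A `&` B).
Proof.
by move=> bA bB; rewrite -[A `&` B]setCK setCI; apply: borelC; apply: borelU; exact: borelC.
Qed.

Lemma borelD A B : borel A -> borel B -> borel (A `\` B).
Proof. by move=> bA bB; rewrite setDE; apply: borelI => //; exact: borelC. Qed.

End BorelSets.

Section CircleFunctions.
Variable R : realType.
Local Notation T := (circle R).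
Implicit Types (f g : T -> C R).

Lemma circle_continuousP f : continuous f <-> forall t (e : R), 0 < e ->
  nbhs t [set s | rnorm (f t - f s) < e].
Proof.
split=> [fc t e|h t V /nbhs_rnormP[e e0 eV]]; first exact: nbhs_rnorm_lt.
by apply: filterS (h t e e0) => s; exact: eV.
Qed.

Lemma continuous_add f g : continuous f -> continuous g -> continuous (fun t => f t + g t).
Proof. by move=> fc gc t; exact: (cvgD (fc t) (gc t)). Qed.

Lemma continuous_scale (a : C R) f : continuous f -> continuous (fun t => a * f t).
Proof. by move=> fc t; exact: (cvgM (cvg_cst a) (fc t)). Qed.

Lemma continuous_lincomb (I : Type) (r : seq I) (a : I -> C R) (f : I -> T -> C R) :
  (forall i, continuous (f i)) -> continuous (fun t => \sum_(i <- r) a i * f i t).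
Proof.
move=> fc; elim: r => [|i r IH].
  rewrite (_ : (fun _ => _) = cst 0); first exact: cst_continuous.
  by apply/funext => t; rewrite big_nil.
rewrite (_ : (fun _ => _) = fun t => a i * f i t + \sum_(j <- r) a j * f j t).
  exact: (continuous_add (@continuous_scale (a i) _ (fc i)) IH).
by apply/funext => t; rewrite big_cons.
Qed.

Lemma continuous_phi (l : int) : continuous (phi (R := R) l).
Proof.
have X n (g : T -> C R) : continuous g -> continuous (fun t => g t ^+ n).
  move=> gc; elim: n => [|n IH].
    rewrite (_ : (fun _ => _) = cst 1); first exact: cst_continuous.
    by apply/funext => t; rewrite expr0.
  rewrite (_ : (fun _ => _) = fun t => g t * g t ^+ n).
    by move=> t; exact: (cvgM (gc t) (IH t)).
  by apply/funext => t; rewrite exprS.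
case: l => n; first exact: (X _ _ (@set_val_continuous R)).
move=> t; apply: (@cvgV _ _ (nbhs t) _ (fun s => (set_val s : C R) ^+ n.+1)).
  by rewrite expf_neq0 // unit_neq0 // norm_circle.
exact: (X _ _ (@set_val_continuous R)).
Qed.

Lemma circle_urysohn (K O : set T) : compact K -> open O -> K `<=` O ->
  exists f : T -> C R, [/\ continuous f, forall t, rnorm (f t) <= 1,
    forall t, K t -> f t = 1 & forall t, ~ O t -> f t = 0].
Proof.
move=> cK oO KO.
have cl : closed (~` O) by exact: open_closedC.
have /normal_separatorP := compact_normal (@circle_hausdorff R) (@circle_compact R).
have OK0 : ~` O `&` K = set0 by rewrite -subset0 => t [nOt /KO].
move=> /(_ R _ _ cl (compact_closed (@circle_hausdorff R) cK) OK0).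
move=> /(@uniform_separatorP _ R)[g [gc g01 g0 g1]].
have RtoCB (a b : R) : RtoC a - RtoC b = RtoC (a - b) by rewrite /RtoC rmorphB.
exists (fun t => RtoC (g t)); split.
- apply/circle_continuousP => t e e0.
  have /cvgrPdist_lt/(_ e e0) := gc t.
  by apply: filterS => s /= gs; rewrite RtoCB rnorm_RtoC.
- move=> t; have : g t \in `[0, 1] by apply: g01; exists t.
  by rewrite in_itv rnorm_RtoC /= => /andP[h1 h2]; rewrite ger0_norm.
- by move=> t Kt; have /= -> := g1 (g t) (ex_intro2 _ _ t Kt erefl).
- by move=> t Ot; have /= -> := g0 (g t) (ex_intro2 _ _ t Ot erefl).
Qed.

(* A finite cover of T by sets where f oscillates little gives the values of s. *)
Lemma simple_approximation f (e : R) : continuous f -> 0 < e ->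
  exists s, simple_fun s /\ forall t, rnorm (f t - s t) < e.
Proof.
move=> fc e0.
pose W u := [set t | rnorm (f t - f u) < e].
have oW u : open (W u).
  rewrite openE => t /= tu; have := nbhs_rnorm_lt fc t (e := e - rnorm (f t - f u)).
  rewrite subr_gt0 => /(_ tu); apply: filterS => s /= ts.
  have := rnormD (f s - f t) (f t - f u); rewrite subrKA (rnorm_distrC (f s) (f t)).
  by move: ts; rewrite /W /=; lra.
pose s r := foldr (fun u acc t => if rnorm (f t - f u) < e then f u else acc t) (fun=> 0) r.
have [D D_T] : exists D : seq T, forall t, exists2 u, u \in D & W u t.
  pose F := filter_from [set: seq T] (fun r => [set r' : seq T | {subset r <= r'}]).
  have FF : Filter F.
    apply: filter_from_filter; first by exists [::].
    move=> r r' _ _; exists (r ++ r') => // r2 /= sr2; split=> u ur; apply: sr2;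
      by rewrite mem_cat ur ?orbT.
  have /compact_near_coveringP cov := @circle_compact R.
  have [|D _ DP] := cov _ F (fun r t => exists2 u, u \in r & W u t) FF.
    move=> t _; exists (W t, [set r : seq T | {subset [:: t] <= r}]) => /=.
      have Wt : W t t by rewrite /W /= subrr rnorm0.
      by split; [exact: (open_nbhs_nbhs (conj (oW t) Wt))|exists [:: t]].
    by move=> [u r] [/= Wu tr]; exists t => //; apply: tr; exact: mem_head.
  by exists D => t; apply: DP.
exists (s D); split.
  split.
    apply: (@sub_finite_set _ _ [set` (0 :: map f D)]); last exact: finite_seq.
    move=> _ [t _ <-]; elim: D {D_T} => [|u r IH] /=; first by rewrite mem_head.
    case: ifP => _; first by rewrite !inE eqxx orbT.
    by move: IH; rewrite /= !inE => /orP[->//|->]; rewrite !orbT.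
  move=> a; elim: D {D_T} => [|u r IH].
    have [->|a0] := eqVneq a 0.
      rewrite (_ : _ @^-1` _ = setT); first by apply: borel_open; exact: openT.
      by rewrite eqEsubset; split.
    rewrite (_ : _ @^-1` _ = set0); first by apply: borel_open; exact: open0.
    by rewrite -subset0 => t /= /esym/eqP; rewrite (negPf a0).
  have bW := borel_open (oW u).
  have -> : s (u :: r) @^-1` [set a] =
      (W u `&` [set t | f u = a]) `|` (~` W u `&` s r @^-1` [set a]).
    rewrite eqEsubset; split=> t /=.
      by case: ifP => h <-; [left|right]; split=> //; rewrite /W /= h.
    by move=> [[-> //]|[/negP/negPf -> //]].
  apply: borelU; last by apply: borelI => //; exact: borelC.
  apply: borelI => //; have [->|fa] := eqVneq (f u) a.
    by apply: borel_open; rewrite (_ : [set _ | _] = setT) ?eqEsubset //; exact: openT.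
  rewrite (_ : [set _ | _] = set0); first by apply: borel_open; exact: open0.
  by rewrite -subset0 => t /= /eqP; rewrite (negPf fa).
move=> t; have [u uD tu] := D_T t; move: uD.
elim: D {D_T} => // v r IH; rewrite inE /= => ur.
case: ifPn => // ntv; apply: IH; move: ur => /orP[/eqP uv|//].
by move: ntv tu; rewrite uv /W /= => /negPf ->.
Qed.

End CircleFunctions.

(** * The representing measure *)

Section Seminorms.
Variables (R : realType) (H : normedModType (C R)).
Variables (dot : {dot H for Num.conj}) (dotE : forall x : H, dot x x = `|x| ^+ 2).

(* Average over z_j = sum_l w^(j l) y_l, w a primitive K-th root of unity: each p_k (y_k) is
   dominated by the mean of the p_k (z_j), while the mean of |z_j|^2 is at most K. *)
Lemma seminorms_bound K (p : nat -> H -> R) (y : nat -> H) (c d : R) :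
  (forall k x z, p k (x + z) <= p k x + p k z) ->
  (forall k a x, p k (a *: x) <= rnorm a * p k x) ->
  (forall x, \sum_(k < K) p k x <= c * rnorm x) -> 0 <= c -> 0 < d ->
  (forall k, rnorm (y k) <= 1) -> (forall k, d <= p k (y k)) ->
  K%:R * d ^+ 2 <= c * (c + 1).
Proof.
move=> pD pZ pc c0 d0 y1 dy; case: (posnP K) => [->|K0].
  by rewrite mul0r mulr_ge0 // addr_ge0.
have [w hw] := @prim_root_exists R K K0.
have KR : (0 : R) < K%:R by rewrite ltr0n.
have wj1 j : rnorm (w ^+ j) = 1.
  by apply: RtoC_inj; rewrite rnormE normrX (norm_unity_root K0 (prim_expr_order hw)) expr1n.
have w0 : w != 0 by rewrite (prim_root_eq0 hw) -lt0n.
have wu : w \is a GRing.unit by rewrite unitfE.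
pose z (j : nat) := \sum_(l < K) w ^+ (j * l) *: y l.
have psum k (F : nat -> H) : p k (\sum_(j < K) F j) <= \sum_(j < K) p k (F j).
  elim/big_rec2: _ => [|j v u _ uv]; last by apply: le_trans (pD _ _ _) _; rewrite lerD2l.
  by have := pZ k 0 0; rewrite scale0r rnorm0 mul0r.
have yE (k : 'I_K) : y k = K%:R^-1 *: \sum_(j < K) (w ^+ (j * k))^-1 *: z j.
  have -> : \sum_(j < K) (w ^+ (j * k))^-1 *: z j = K%:R *: y k; last first.
    by rewrite scalerA mulVf ?scale1r // pnatr_eq0 -lt0n.
  under eq_bigr do rewrite scaler_sumr; rewrite exchange_big (bigD1 k) //=.
  rewrite [X in _ + X]big1 ?addr0 => [|l lk].
    under eq_bigr do rewrite scalerA mulVf ?scale1r ?expf_neq0 //.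
    by rewrite sumr_const card_ord scaler_nat.
  under eq_bigr do rewrite scalerA; rewrite -scaler_suml.
  have -> : \sum_(j < K) (w ^+ (j * k))^-1 * w ^+ (j * l) =
      \sum_(j < K) (w ^ (l%:Z - k%:Z)) ^+ j.
    apply: eq_bigr => j _; rewrite expfzDr // -exprz_inv -!exprnP exprMn -!exprM exprVn.
    by rewrite mulrC ![(j * _)%N]mulnC.
  rewrite prim_root_sum //; case: ifPn; rewrite ?scale0r // dvdzE /= => /dvdn_leq mkl.
  exfalso; suff /mkl : (0 < `|l%:Z - k%:Z|)%N.
    by have := ltn_ord k; have := ltn_ord l; lia.
  by rewrite absz_gt0 subr_eq0; apply: contra lk => /eqP[/val_inj->].
have h1 (k : 'I_K) : K%:R * d <= \sum_(j < K) p k (z j).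
  rewrite -ler_pdivlMl //; apply: le_trans (dy k) _; rewrite [in leLHS]yE.
  apply: le_trans (pZ _ _ _) _; rewrite rnormV rnorm_nat ler_wpM2l ?invr_ge0 //.
  apply: le_trans (psum k (fun j => (w ^+ (j * k))^-1 *: z j)) _; apply: ler_sum => j _.
  by apply: le_trans (pZ _ _ _) _; rewrite rnormV wj1 invr1 mul1r.
have h2 : K%:R * (K%:R * d) <= c * \sum_(j < K) rnorm (z j).
  rewrite mulr_sumr.
  apply: le_trans (_ : \sum_(k < K) \sum_(j < K) p k (z j) <= _).
    apply: le_trans (_ : \sum_(k < K) K%:R * d <= _); last by apply: ler_sum => k _.
    by rewrite sumr_const card_ord -[(K%:R * d) *+ K]mulr_natl.
  by rewrite exchange_big; apply: ler_sum => j _; exact: pc.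
have h3 : \sum_(j < K) rnorm (z j) ^+ 2 <= K%:R * K%:R.
  rewrite (plancherel dotE y hw (leqnn K)) ler_wpM2l //.
  apply: le_trans (_ : \sum_(l < K) 1 <= _); last by rewrite sumr_const card_ord.
  by apply: ler_sum => l _; rewrite expr_le1 ?rnorm_ge0.
(* The mean of |z_j| is compared with that of |z_j|^2 by 2 t r <= t^2 r^2 + 1. This t gives c t <=
   d, so the quadratic term is absorbed and t K d <= c remains; c + 1 instead of c allows c = 0. *)
pose t := d / (c + 1); have t0 : 0 < t by rewrite divr_gt0 //; lra.
have tc : t * (c + 1) = d by rewrite /t divfK //; lra.
have h4 : 2 * t * \sum_(j < K) rnorm (z j) <= t ^+ 2 * (K%:R * K%:R) + K%:R.
  apply: le_trans (_ : \sum_(j < K) (t ^+ 2 * rnorm (z j) ^+ 2 + 1) <= _).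
    rewrite mulr_sumr; apply: ler_sum => j _.
    by have := sqr_ge0 (t * rnorm (z j) - 1); nra.
  rewrite big_split /= -mulr_sumr sumr_const card_ord lerD2r ler_wpM2l //.
  exact: sqr_ge0.
have h5 : 2 * t * (K%:R * d) <= c * (t ^+ 2 * K%:R + 1).
  rewrite -(ler_pM2l KR).
  have := ler_wpM2l (ltW (mulr_gt0 (ltr0n R 2 : 0 < 2%:R) t0)) h2.
  have := ler_wpM2l c0 h4; nra.
have h6 : t * (K%:R * d) <= c.
  have : c * (t ^+ 2 * K%:R) <= d * (t * K%:R).
    have -> : c * (t ^+ 2 * K%:R) = c * t * (t * K%:R) by ring.
    have ct : c * t <= d by rewrite -tc mulrDr mulr1 mulrC lerDl ltW.
    by apply: ler_wpM2r => //; rewrite mulr_ge0 // ltW.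
  lra.
have -> : K%:R * d ^+ 2 = t * (K%:R * d) * (c + 1) by rewrite -tc; ring.
by rewrite ler_wpM2r // addr_ge0.
Qed.

End Seminorms.

(** * Extension from continuous functions to Borel sets *)

Section SetFunction.
Variables (R : realType) (H : completeNormedModType (C R)).
Local Notation T := (circle R).
(* [Phi f x] plays the role of the integral of f against mu_x, and the finitely
   additive [L x], once regularized, that of the variation of mu_x. *)
Variables (Phi : (T -> C R) -> H -> H) (L : H -> set T -> R) (c : R).
Hypothesis c_ge0 : 0 <= c.
Hypothesis PhiD : forall (f g : T -> C R) x, continuous f -> continuous g ->
  Phi (fun t => f t + g t) x = Phi f x + Phi g x.
Hypothesis PhiZ : forall a (f : T -> C R) x, continuous f ->
  Phi (fun t => a * f t) x = a *: Phi f x.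
Hypothesis Phi_linear : forall (f : T -> C R) a x y, continuous f ->
  Phi f (a *: x + y) = a *: Phi f x + Phi f y.
Hypothesis L_additive : forall x, finitely_additive (L x).
Hypothesis LT : forall x, L x setT <= c * rnorm x.
Hypothesis L_scale : forall a x S, L (a *: x) S = rnorm a * L x S.
Hypothesis L_add : forall x y S, L (x + y) S <= L x S + L y S.
Hypothesis Phi_le : forall (f : T -> C R) x M e (G : set T),
  continuous f -> 0 <= M -> 0 <= e -> open G ->
  (forall t, rnorm (f t) <= M) -> (forall t, ~ G t -> rnorm (f t) <= e) ->
  rnorm (Phi f x) <= M * inner_content (L x) G + e * (c * rnorm x).
Implicit Types (f g : T -> C R) (x y : H) (A B O K : set T).
Let c1_gt0 : 0 < c + 1. Proof. by rewrite ltr_wpDl. Qed.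
Local Notation lam x := (inner_content (L x)).
Local Notation out x := (outer_content (L x)).
Let hT := @circle_hausdorff R.
Let cT := @circle_compact R.

Lemma regular_L x B : borel B -> regular_for (L x) B.
Proof. exact: regular_borel. Qed.

Lemma inner_L_add x y O : lam (x + y) O <= lam x O + lam y O.
Proof.
apply: inner_le => // K cK KO; apply: le_trans (L_add x y K) _.
by apply: lerD; apply: inner_ge.
Qed.

Lemma inner_L_scale a x O : lam (a *: x) O <= rnorm a * lam x O.
Proof.
apply: inner_le => // K cK KO; rewrite L_scale ler_wpM2l ?rnorm_ge0 //.
exact: inner_ge.
Qed.

Lemma outer_L_add x y B : out (x + y) B <= out x B + out y B.
Proof.
apply/ler_addgt0Pr => e e0; have e2 : 0 < e / 2 by lra.
have [P [oP BP lP]] := outer_adherent (L_additive x) B e2.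
have [Q [oQ BQ lQ]] := outer_adherent (L_additive y) B e2.
have : out (x + y) B <= lam (x + y) (P `&` Q).
  by apply: outer_le => //; [exact: openI|move=> t Bt; split; [exact: BP|exact: BQ]].
have := inner_L_add x y (P `&` Q).
have := le_inner (L_additive x) (@subIsetl _ P Q).
have := le_inner (L_additive y) (@subIsetr _ P Q).
lra.
Qed.

Lemma outer_L_scale a x B : out (a *: x) B <= rnorm a * out x B.
Proof.
apply/ler_addgt0Pr => e e0; have na := rnorm_ge0 a.
have d0 : 0 < e / (rnorm a + 1) by rewrite divr_gt0 //; lra.
have [P [oP BP lP]] := outer_adherent (L_additive x) B d0.
have h1 : out (a *: x) B <= lam (a *: x) P by apply: outer_le.
apply: (le_trans h1); apply: (le_trans (inner_L_scale a x P)).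
apply: (@le_trans _ _ (rnorm a * (out x B + e / (rnorm a + 1)))).
  by rewrite ler_wpM2l // ltW.
rewrite mulrDr lerD2l mulrA ler_pdivrMr; first nra.
lra.
Qed.

Lemma outer_L_le x B : out x B <= c * rnorm x.
Proof. by apply: le_trans (outer_leT _ _) (LT x). Qed.

Lemma outer_L_partition n (B : 'I_n -> set T) S x : borel_partition B S ->
  \sum_(i < n) out x (B i) <= out x S.
Proof.
move=> [bB tB <-]; apply: outer_partition => // i; exact: regular_L.
Qed.

(** One pair K, O serves finitely many vectors; the whole unit ball at once needs
    [uniform_regular]. *)
Lemma common_regular (xs : seq H) B e : borel B -> 0 < e -> exists K O,
  [/\ compact K, open O, K `<=` B, B `<=` O & forall x, x \in xs -> lam x (O `\` K) < e].
Proof.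
move=> bB e0; elim: xs => [|x xs [K [P [cK oP KB BP lKP]]]].
  by exists set0, setT; split=> //; [exact: compact0|exact: openT].
have [K' [P' [cK' oP' KB' BP' lKP']]] := regular_L x bB e0.
exists (K `|` K'), (P `&` P'); split.
- exact: compactU.
- exact: openI.
- by rewrite subUset.
- by rewrite subsetI.
- move=> y; rewrite inE => /orP[/eqP->|yxs].
    apply: le_lt_trans lKP'; apply: le_inner => // t [[Pt P't] nKt]; split=> // K't.
    by apply: nKt; right.
  apply: le_lt_trans (lKP y yxs); apply: le_inner => // t [[Pt P't] nKt]; split=> // Kt.
  by apply: nKt; left.
Qed.

Definition indicator B (t : T) : C R := if t \in B then 1 else 0.

(** Stands for L^1-closeness of f to the indicator of B under the regularized [L x], expressed
    without integration. *)
Definition approximates f B x (e : R) := [/\ continuous f, forall t, rnorm (f t) <= 1 &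
  exists G, [/\ open G, lam x G < e & forall t, ~ G t -> f t = indicator B t]].

Lemma approximation (xs : seq H) B O e : borel B -> open O -> B `<=` O -> 0 < e ->
  exists f, (forall t, ~ O t -> f t = 0) /\ forall x, x \in xs -> approximates f B x e.
Proof.
move=> bB oO BO e0; have [K [P [cK oP KB BP lKP]]] := common_regular xs bB e0.
have [|f [fc f1 fK fO]] := circle_urysohn cK (openI oP oO).
  by move=> t Kt; split; [apply: BP|apply: BO]; exact: KB.
exists f; split=> [t Ot|x xxs]; first by apply: fO => -[].
split=> //; exists (P `\` K); split; [exact: open_setD|exact: lKP|].
move=> t Gt; rewrite /indicator; case: ifPn => [/set_mem Bt|/negP nBt].
  by apply: fK; apply: contrapT => nKt; apply: Gt; split=> //; exact: BP.
apply: fO => -[Pt _]; apply: Gt; split=> // Kt; apply: nBt; apply: mem_set; exact: KB.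
Qed.

Lemma PhiB f g x : continuous f -> continuous g ->
  Phi (fun t => f t - g t) x = Phi f x - Phi g x.
Proof.
move=> fc gc; have ngc := @continuous_scale _ (-1) g gc.
have h := @PhiD f (fun t => -1 * g t) x fc ngc.
rewrite (@PhiZ (-1) g x gc) scaleN1r in h; rewrite -h; congr (Phi _ x).
by apply/funext => t; rewrite mulN1r.
Qed.

Lemma approximates_dist f g B x d e : approximates f B x d -> approximates g B x e ->
  rnorm (Phi f x - Phi g x) <= 2 * (d + e).
Proof.
move=> [fc f1 [G [oG lG fG]]] [gc g1 [G' [oG' lG' gG']]]; rewrite -(PhiB x fc gc).
have fgc : continuous (fun t => f t - g t).
  move=> t; exact: (cvgB (fc t) (gc t)).
have := @Phi_le _ x 2 0 (G `|` G') fgc _ _ (openU oG oG') _ _.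
move=> /(_ _ _ _ _)/le_trans; apply => //.
- move=> t; have := rnormD (f t) (- g t); rewrite rnormN.
  by have := f1 t; have := g1 t; lra.
- move=> t nGt; rewrite fG ?gG' ?subrr ?rnorm0 //; first by move=> h; apply: nGt; right.
  by move=> h; apply: nGt; left.
- have := innerU hT cT (L_additive x) oG oG'; lra.
Qed.

(** Approximants with errors 1/(n + 1) give a Cauchy sequence. Stating the bound for all
    approximants determines v and allows one f to serve several vectors. *)
Lemma set_function_exists B x : borel B -> exists v, forall f e,
  approximates f B x e -> rnorm (Phi f x - v) <= 2 * e.
Proof.
move=> bB; have i0 n : 0 < (n.+1%:R : R)^-1 by rewrite invr_gt0 ltr0n.
have /choice[f fB] : forall n, exists f, approximates f B x n.+1%:R^-1.
  move=> n; have [f [_ fP]] := approximation [:: x] bB openT (@subsetT _ B) (i0 n).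
  by exists f; apply: fP; rewrite mem_head.
have fc : cvg (Phi (f n) x @[n --> \oo]).
  apply: cauchy_rnorm => e e0; have [|N NP] := @small_inv R (e / 4); first lra.
  exists N => m n Nm Nn; apply: le_lt_trans (approximates_dist (fB m) (fB n)) _.
  have := NP m Nm; have := NP n Nn; move: (n.+1%:R^-1) (m.+1%:R^-1) => a b; lra.
exists (lim (Phi (f n) x @[n --> \oo])) => g e gB.
apply/ler_addgt0Pr => d d0; have d4 : 0 < d / 4 by lra.
have [N NP] := (cvgn_rnormP _ _).1 fc (d / 4) d4; have [N' N'P] := @small_inv R _ d4.
pose n := maxn N N'.
have := NP n (leq_maxl _ _); have := N'P n (leq_maxr _ _).
have := approximates_dist gB (fB n).
set l := lim _; have := rnormD (Phi g x - Phi (f n) x) (Phi (f n) x - l).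
rewrite subrKA (rnorm_distrC (Phi (f n) x) l); move: (n.+1%:R^-1) => a; lra.
Qed.

(** Linearity is tested on a single f that approximates B for x, y and a x + y simultaneously.
    Nothing is claimed for sets that are not Borel. *)
Lemma operator_exists B : exists b : bop H H, borel B -> forall x f e,
  approximates f B x e -> rnorm (Phi f x - b x) <= 2 * e.
Proof.
have [bB|nB] := pselect (borel B); last by exists 0 => /nB.
have /choice[v vP] : forall x, exists v, forall f e,
    approximates f B x e -> rnorm (Phi f x - v) <= 2 * e.
  by move=> x; exact: set_function_exists.
suff vl : v \in @bounded_linear_pred R H H by exists (Bop vl) => _.
apply/mem_set; split=> [a x y|].
  apply/eqP; rewrite -subr_eq0; apply/eqP/rnorm_eq0/le_anti; rewrite rnorm_ge0 andbT.
  apply/ler_addgt0Pr => e e0; rewrite add0r; have na := rnorm_ge0 a.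
  pose d := e / (2 * (2 + rnorm a)); have d0 : 0 < d by rewrite divr_gt0 //; lra.
  have [f [_ fP]] := approximation [:: x; y; a *: x + y] bB openT (@subsetT _ B) d0.
  have fx := fP x; have fy := fP y; have fz := fP (a *: x + y).
  move: fx fy fz; rewrite !inE !eqxx !orbT.
  move=> /(_ isT) fx /(_ isT) fy /(_ isT) fz; have [fc _ _] := fx.
  have := vP _ _ _ fx; have := vP _ _ _ fy; have := vP _ _ _ fz.
  rewrite Phi_linear // => hz hy hx.
  have -> : v (a *: x + y) - (a *: v x + v y) =
      - (a *: Phi f x + Phi f y - v (a *: x + y)) +
      (a *: (Phi f x - v x) + (Phi f y - v y)).
    by rewrite scalerBr [X in _ = _ + X]addrACA opprB [RHS]addrA subrK -opprD.
  have h1 := rnormD (- (a *: Phi f x + Phi f y - v (a *: x + y)))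
    (a *: (Phi f x - v x) + (Phi f y - v y)).
  have h2 := rnormD (a *: (Phi f x - v x)) (Phi f y - v y).
  rewrite rnormN in h1; rewrite rnormZ in h2.
  have h3 := ler_wpM2l na hx.
  have h4 : 2 * (2 + rnorm a) * d = e by rewrite /d; field; lra.
  nra.
exists c => x; apply/ler_addgt0Pr => e e0; have e2 : 0 < e / 2 by lra.
have [f [_ fP]] := approximation [:: x] bB openT (@subsetT _ B) e2.
have fB := fP x (mem_head _ _); have [fc f1 _] := fB.
have := vP _ _ _ fB; have := Phi_le x fc ler01 (lexx 0) openT f1.
move=> /(_ (fun t nt => False_ind _ (nt I))); rewrite mul0r addr0 mul1r.
have := inner_leT (L_additive x) setT; have := LT x.
have := rnormD (v x - Phi f x) (Phi f x); rewrite subrK (rnorm_distrC (v x)); lra.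
Qed.

Lemma Phi_lincomb (I : Type) (r : seq I) (a : I -> C R) (f : I -> T -> C R) x :
  (forall i, continuous (f i)) ->
  Phi (fun t => \sum_(i <- r) a i * f i t) x = \sum_(i <- r) a i *: Phi (f i) x.
Proof.
move=> fc; elim: r => [|i r IH].
  have := @PhiZ 0 (cst 0) x (@cst_continuous _ _ _); rewrite scale0r big_nil => <-.
  by congr Phi; apply/funext => t; rewrite big_nil mul0r.
have h := @PhiD _ _ x (@continuous_scale _ (a i) _ (fc i)) (@continuous_lincomb _ _ r a f fc).
rewrite (@PhiZ (a i) (f i) x (fc i)) IH in h; rewrite big_cons -h; congr (Phi _ x).
by apply/funext => t; rewrite big_cons.
Qed.

(** * From pointwise to uniform smallness on the unit ball *)

Section UniformDecrease.
Variables (dot : {dot H for Num.conj}) (dotE : forall x : H, dot x x = `|x| ^+ 2).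

(** A gliding hump: if uniformity fails, X N in the unit ball has content above e on D N, but below
    e / 2 on D (M N). Iterating M yields disjoint differences B k, on each of which some unit-ball
    vector keeps content at least e / 2, against [seminorms_bound]. *)
Lemma uniform_outer (D : nat -> set T) : (forall n, borel (D n)) ->
  {homo D : m n / (m <= n)%N >-> n `<=` m} ->
  (forall x e, 0 < e -> exists N, forall n, (N <= n)%N -> out x (D n) < e) ->
  forall e, 0 < e -> exists N, forall n, (N <= n)%N ->
    forall x, rnorm x <= 1 -> out x (D n) <= e.
Proof.
move=> bD dD D0 e e0; apply: contrapT => noN.
have /choice[X XP] : forall N, exists x, rnorm x <= 1 /\ e < out x (D N).
  move=> N; apply: contrapT => nox; apply: noN; exists N => n Nn x x1.
  rewrite leNgt; apply/negP => ex; apply: nox; exists x; split=> //.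
  by apply: lt_le_trans ex _; apply: le_outer => //; exact: dD.
have /choice[M MP] : forall N, exists n, (N <= n)%N /\ out (X N) (D n) < e / 2.
  move=> N; have [|n nP] := D0 (X N) (e / 2); first lra.
  by exists (maxn N n); rewrite leq_maxl; split=> //; apply: nP; exact: leq_maxr.
pose s k := iter k M 0%N.
have smono j k : (j <= k)%N -> (s j <= s k)%N.
  move=> /subnK <-; elim: (k - j)%N => // i IH.
  by rewrite addSn /s iterS; apply: leq_trans IH _; have [] := MP (s (i + j)%N).
pose B k := D (s k) `\` D (s k.+1).
have bB k : borel (B k) by apply: borelD.
have Bdisj j k t : (j < k)%N -> B j t -> ~ B k t.
  by move=> jk [_ nDj] [Dk _]; apply: nDj; apply: dD Dk; exact: smono.
pose K := (Num.bound (c * (c + 1) / (e / 2) ^+ 2)).+1.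
have := @seminorms_bound _ _ _ dotE K (fun k x => out x (B k)) (fun k => X (s k)) c (e / 2).
move=> /(_ _ _ _ c_ge0 _ _ _) h.
have : K%:R * (e / 2) ^+ 2 <= c * (c + 1).
  apply: h.
  - by move=> k x y; exact: outer_L_add.
  - by move=> k a x; exact: outer_L_scale.
  - move=> x; apply: le_trans (outer_L_le x (\bigcup_(i : 'I_K) B i)).
    apply: outer_L_partition; split=> // i j _ _ [t [Bi Bj]]; apply/val_inj.
    have [ij|ij|//] := ltngtP i j; first by have := Bdisj _ _ _ ij Bi Bj.
    by have := Bdisj _ _ _ ij Bj Bi.
  - lra.
  - by move=> k; have [] := XP (s k).
  - move=> k; have [_ h1] := XP (s k); have [_ h2] := MP (s k).
    have : out (X (s k)) (D (s k)) <= out (X (s k)) (B k) + out (X (s k)) (D (s k.+1)).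
      apply: le_trans (outerU hT cT (L_additive _) _ _); apply: le_outer => // t Dt.
      by have [Dt'|nDt'] := pselect (D (s k.+1) t); [right|left].
    by rewrite /s iterS -/(s k); lra.
apply/negP; rewrite -ltNge -ltr_pdivrMr ?exprn_gt0 //; last lra.
apply: lt_trans (_ : (Num.bound (c * (c + 1) / (e / 2) ^+ 2))%:R < _); last by rewrite ltr_nat.
by apply: archi_boundP; rewrite divr_ge0 ?sqr_ge0 // mulr_ge0 // addr_ge0.
Qed.

(** Separability provides a sequence of pairs regularizing B along a dense sequence; made monotone,
    their gaps D n have content tending to 0 for every x. The gaps may have nonempty intersection,
    which is why [uniform_outer] assumes pointwise convergence rather than an empty intersection. *)
Lemma uniform_regular B e : (exists2 Q : set H, countable Q & dense Q) ->
  borel B -> 0 < e -> exists K O, [/\ compact K, open O, K `<=` B, B `<=` O &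
    forall x, rnorm x <= 1 -> out x (O `\` K) <= e].
Proof.
move=> [Q Qc Qd] bB e0.
have [q qP] : exists q : nat -> H, forall x (d : R), 0 < d -> exists n, rnorm (x - q n) < d.
  have [f finj] := countable_injP _ Qc.
  have /choice[q qP] : forall n, exists x, (exists2 y, Q y & f y = n) -> Q x /\ f x = n.
    move=> n; have [[y Qy fy]|ny] := pselect (exists2 y, Q y & f y = n); last by exists 0.
    by exists y.
  exists q => x d d0.
  have xd : nbhs x [set y | rnorm (x - y) < d] by apply/nbhs_rnormP; exists d.
  have [||y [/interior_subset xy Qy]] := Qd (interior [set y | rnorm (x - y) < d]).
  - by exists x.
  - exact: open_interior.
  exists (f y); have [Qq fq] := qP (f y) (ex_intro2 _ _ y Qy erefl).
  by have -> : q (f y) = y by apply: finj => //; exact: mem_set.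
have i0 n : 0 < (n.+1%:R : R)^-1 by rewrite invr_gt0 ltr0n.
have /choice[KO KOP] : forall n, exists KO : set T * set T,
    [/\ compact KO.1, open KO.2, KO.1 `<=` B, B `<=` KO.2 &
    forall x, x \in map q (iota 0 n.+1) -> lam x (KO.2 `\` KO.1) < n.+1%:R^-1].
  move=> n; have [K [P h]] := common_regular (map q (iota 0 n.+1)) bB (i0 n).
  by exists (K, P).
pose KK n := \big[setU/set0]_(i < n.+1) (KO i).1.
pose OO n := ~` \big[setU/set0]_(i < n.+1) ~` (KO i).2.
have KKc n : compact (KK n) by apply: bigsetU_compact => i _; have [] := KOP i.
have KKB n : KK n `<=` B.
  rewrite /KK -(bigcup_mkord n.+1 (fun i => (KO i).1)) => t [i _ Kt].
  by have [_ _ + _ _] := KOP i; apply.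
have OOB n : B `<=` OO n.
  rewrite /OO -(bigcup_mkord n.+1 (fun i => ~` (KO i).2)) => t Bt [i _]; apply.
  by have [_ _ _ + _] := KOP i; apply.
have OOo n : open (OO n).
  rewrite /OO; apply: closed_openC; rewrite -(bigcup_mkord n.+1 (fun i => ~` (KO i).2)).
  apply: closed_bigcup => [|i _]; first exact: finite_II.
  by apply: open_closedC; have [] := KOP i.
pose D n := OO n `\` KK n.
have oD n : open (D n) by exact: open_setD.
have [|||N NP] := @uniform_outer D _ _ _ e e0.
- by move=> n; exact: borel_open.
- move=> m n mn; apply: setDSS; last exact: (@subset_bigsetU _ (fun i => (KO i).1)).
  apply: subsetC; exact: (@subset_bigsetU _ (fun i => ~` (KO i).2)).
- move=> x d d0; have [|i xi] := qP x (d / (2 * (c + 1))); first by rewrite divr_gt0 // mulr_gt0.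
  exists (maxn i (Num.bound (2 / d))) => n; rewrite geq_max => /andP[in_ Nn].
  have h1 : out x (D n) <= out (x - q i) (D n) + out (q i) (D n).
    by rewrite -{1}(subrK (q i) x); exact: outer_L_add.
  have h2 := outer_L_le (x - q i) (D n).
  have h3 : c * rnorm (x - q i) <= d / 2.
    apply: le_trans (_ : (c + 1) * (d / (2 * (c + 1))) <= _).
      by apply: ler_pM; rewrite ?rnorm_ge0 ?lerDl // ltW.
    by rewrite le_eqVlt; apply/orP; left; apply/eqP; field; exact: lt0r_neq0.
  have h4 : out (q i) (D n) < n.+1%:R^-1.
    have [_ _ _ _ /(_ (q i)) lq] := KOP n.
    apply: le_lt_trans (lq _); last by apply: map_f; rewrite mem_iota.
    apply: outer_le => //; first by have [? ? _ _ _] := KOP n; exact: open_setD.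
    apply: setDSS.
      by rewrite /OO big_ord_recr /= setCU setCK; exact: subIsetr.
    by rewrite /KK big_ord_recr /=; exact: subsetUr.
  have h5 : n.+1%:R^-1 < d / 2.
    rewrite -[d / 2]invrK invf_div ltf_pV2 ?posrE ?ltr0n ?divr_gt0 //.
    apply: lt_le_trans (archi_boundP _) _; first by rewrite divr_ge0 // ltW.
    by rewrite ler_nat (leq_trans Nn).
  by move: (n.+1%:R^-1) h4 h5 => a h4 h5; lra.
by exists (KK N), (OO N); split=> //; exact: NP.
Qed.

End UniformDecrease.

(** * Additivity, regularity and Fourier coefficients of the measure *)

Section Representation.
Variable mu : set T -> bop H H.
Hypothesis mu_approx : forall B x f e, borel B -> approximates f B x e ->
  rnorm (Phi f x - mu B x) <= 2 * e.

(** Approximants may be supported in any open P containing B, so [Phi f x] sees only the content of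
    P. *)
Lemma mu_le B x : borel B -> rnorm (mu B x) <= out x B.
Proof.
move=> bB; apply/ler_addgt0Pr => e e0; have e3 : 0 < e / 3 by lra.
have [P [oP BP lP]] := outer_adherent (L_additive x) B e3.
have [f [f0 fP]] := approximation [:: x] bB oP BP e3.
have fB := fP x (mem_head _ _); have [fc f1 _] := fB.
have := mu_approx bB fB.
have := Phi_le x fc ler01 (lexx 0) oP f1.
have h t : ~ P t -> rnorm (f t) <= 0 by move=> /f0 ->; rewrite rnorm0.
move=> /(_ h); rewrite mul0r addr0 mul1r.
have := rnormD (mu B x - Phi f x) (Phi f x); rewrite subrK (rnorm_distrC (mu B x)); lra.
Qed.

(** Each indicator is replaced by a continuous approximant. Off the exceptional sets the distance to
    g stays at most e; on them it is bounded while their content is arbitrarily small. The case g =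
    0, e = 0 gives finite additivity, g = [phi l] the Fourier coefficients. *)
Lemma mu_lincomb (I : Type) (r : seq I) (a : I -> C R) (B : I -> set T) g x e :
  (forall i, borel (B i)) -> continuous g -> 0 <= e ->
  (forall t, rnorm (\sum_(i <- r) a i * indicator (B i) t - g t) <= e) ->
  rnorm (\sum_(i <- r) a i *: mu (B i) x - Phi g x) <= e * (c * rnorm x).
Proof.
move=> bB gc e0 ge; set K := e * _.
have [M M0 gM] := circle_bounded gc.
pose S := \sum_(i <- r) rnorm (a i).
have S0 : 0 <= S by apply: sumr_ge0 => i _; exact: rnorm_ge0.
pose N : R := (size r)%:R; have N0 : 0 <= N by [].
(* With d' = d / q, the amount 2 S d' pays for replacing the indicators and (S + M) N d' for the
   exceptional sets. *)
apply/ler_addgt0Pr => d d0; pose q := 2 * S + (S + M) * N + 1.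
have q0 : 0 < q by rewrite /q; nra.
pose d' := d / q; have d'0 : 0 < d' by exact: divr_gt0.
have d'q : d' * q = d by rewrite /d' divfK // gt_eqF.
have /choice[f fP] : forall i, exists f, approximates f (B i) x d'.
  move=> i; have [f [_ fP]] := approximation [:: x] (bB i) openT (@subsetT _ _) d'0.
  by exists f; apply: fP; rewrite mem_head.
have fc i : continuous (f i) by have [] := fP i.
have /choice[G GP] : forall i, exists G, [/\ open G, lam x G < d' &
    forall t, ~ G t -> f i t = indicator (B i) t] by move=> i; have [] := fP i.
pose h t := \sum_(i <- r) a i * f i t - g t.
have sc : continuous (fun t => \sum_(i <- r) a i * f i t) by exact: continuous_lincomb.
have hc : continuous h by move=> t; exact: (cvgB (sc t) (gc t)).
have hM t : rnorm (h t) <= S + M.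
  have := rnormD (\sum_(i <- r) a i * f i t) (- g t); rewrite rnormN.
  have : rnorm (\sum_(i <- r) a i * f i t) <= S.
    apply: le_trans (rnorm_sum _ _ _) _; apply: ler_sum => i _.
    by rewrite rnormM ler_piMr ?rnorm_ge0 //; have [] := fP i.
  have := gM t; rewrite /h; lra.
pose GG := \big[setU/set0]_(i <- r) G i.
have oG i : open (G i) by have [] := GP i.
have oGG : open GG by exact: bigsetU_open.
have hG t : ~ GG t -> rnorm (h t) <= e.
  rewrite /GG => nGt; suff -> : h t = \sum_(i <- r) a i * indicator (B i) t - g t by [].
  rewrite /h; congr (_ - _); elim: (r) nGt => [|i r' IH]; first by rewrite !big_nil.
  rewrite !big_cons => /not_orP[nGi nGr].
  by have [_ _ ->] := GP i; rewrite // IH.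
have lGG : lam x GG <= d' * N.
  apply: le_trans (inner_bigU hT cT (L_additive x) _ oG) _.
  apply: (@le_trans _ _ (\sum_(i <- r) d')).
    by apply: ler_sum => i _; have [_ /ltW] := GP i.
  by rewrite big_const_seq count_predT iter_addr_0 -[d' *+ _]mulr_natr.
have h1 := Phi_le x hc (addr_ge0 S0 M0) e0 oGG hM hG.
rewrite /h (PhiB x sc gc) (Phi_lincomb r a x fc) -/K in h1.
have h2 : rnorm (\sum_(i <- r) a i *: mu (B i) x - \sum_(i <- r) a i *: Phi (f i) x) <=
    S * (2 * d').
  rewrite -sumrB mulr_suml; apply: le_trans (rnorm_sum _ _ _) _.
  apply: ler_sum => i _; rewrite -scalerBr rnormZ ler_wpM2l ?rnorm_ge0 // rnorm_distrC.
  exact: mu_approx.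
have := rnormD (\sum_(i <- r) a i *: mu (B i) x - \sum_(i <- r) a i *: Phi (f i) x)
  (\sum_(i <- r) a i *: Phi (f i) x - Phi g x).
rewrite subrKA; have : (S + M) * lam x GG <= (S + M) * (d' * N) by rewrite ler_wpM2l // addr_ge0.
by rewrite -d'q /q; nra.
Qed.

Lemma mu_setU A B : borel A -> borel B -> A `&` B = set0 -> mu (A `|` B) = mu A + mu B.
Proof.
move=> bA bB AB; apply: bopP => x; rewrite bop_addE.
pose a (i : nat) : C R := if i is 0%N then 1 else -1.
pose S (i : nat) := match i with 0%N => A `|` B | 1%N => A | _ => B end.
have bS i : borel (S i) by case: i => [|[|i]] //=; exact: borelU.
have P0 : Phi (cst 0) x = 0.
  have := @PhiZ 0 (cst 0) x (@cst_continuous _ _ _); rewrite scale0r => <-.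
  by congr Phi; apply/funext => t; rewrite mul0r.
have := @mu_lincomb nat [:: 0; 1; 2]%N a S (cst 0) x 0 bS (@cst_continuous _ _ _) (lexx 0).
rewrite P0 subr0 !big_cons big_nil mul0r addr0 !scaleN1r scale1r => h.
apply/eqP; rewrite -subr_eq0 opprD; apply/eqP/rnorm_eq0/le_anti; rewrite rnorm_ge0 andbT.
apply: h => t; rewrite !big_cons big_nil /a /S /indicator in_setU addr0 subr0.
case: (boolP (t \in A)) => tA; case: (boolP (t \in B)) => tB /=.
- by have : (A `&` B) t by [split; exact: set_mem]; rewrite AB.
- by rewrite mul1r mulr1 mulr0 addr0 subrr rnorm0.
- by rewrite mul1r mulr1 mulr0 add0r subrr rnorm0.
- by rewrite !mulr0 !addr0 rnorm0.
Qed.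

Lemma mu_opnorm A e : borel A -> (forall x, rnorm x <= 1 -> out x A <= e) ->
  rnorm (mu A) <= e.
Proof.
move=> bA Ae; rewrite bop_normE; apply: opnorm_le => x x1.
by apply: le_trans (Ae x x1); exact: mu_le.
Qed.

Lemma mu_tail (A : nat -> set T) n : (forall k, borel (A k)) -> trivIset setT A ->
  mu (\bigcup_k A k) = \sum_(i < n) mu (A i) + mu (\bigcup_k A (n + k)%N).
Proof.
move=> bA tA; elim: n => [|n ->]; first by rewrite big_ord0 add0r.
rewrite big_ord_recr /= -addrA; congr (_ + _); rewrite -mu_setU //.
- congr (mu _); rewrite eqEsubset; split=> t.
    move=> [[|k] _ At]; first by left; rewrite addn0 in At.
    by right; exists k => //; rewrite addSnnS.
  move=> [At|[k _ At]]; first by exists 0%N => //; rewrite addn0.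
  by exists k.+1 => //; rewrite addnS -addSn.
- exact: borel_bigcup.
- rewrite -subset0 => t [At [k _ Akt]].
  by have := tA n (n.+1 + k)%N I I (ex_intro _ t (conj At Akt)); lia.
Qed.

Variables (dot : {dot H for Num.conj}) (dotE : forall x : H, dot x x = `|x| ^+ 2).

Lemma norm_vector_measure : vector_measure mu.
Proof.
move=> A bA tA; apply/cvgn_rnormP => e e0.
pose D n := \bigcup_k A (n + k)%N.
have bD n : borel (D n) by exact: borel_bigcup.
have dD : {homo D : m n / (m <= n)%N >-> n `<=` m}.
  by move=> m n mn t [k _ At]; exists (n - m + k)%N => //; rewrite addnA subnKC.
have D0 : \bigcap_n D n = set0.
  rewrite -subset0 => t Dt; have [k _ At] := Dt 0%N I; rewrite add0n in At.
  have [l _ Akt] := Dt k.+1 I.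
  by have := tA k (k.+1 + l)%N I I (ex_intro _ t (conj At Akt)); lia.
have [||||N NP] := @uniform_outer dot dotE D _ _ _ (e / 2).
- by [].
- by [].
- move=> x d d0; apply: (outer_decreasing hT cT (L_additive x) _ dD D0 d0) => n.
  exact: regular_L.
- lra.
exists N => n Nn; rewrite (mu_tail n bA tA) addrC addKr.
by apply: (@le_lt_trans _ _ (e / 2)); [apply: mu_opnorm; [exact: bD|exact: (NP n Nn)]|lra].
Qed.

Lemma eval_vector_measure x : vector_measure (eval_measure mu x).
Proof.
move=> A bA tA; apply/cvgn_rnormP => e e0.
have [|N NP] := (cvgn_rnormP _ _).1 (norm_vector_measure bA tA) (e / (rnorm x + 1)).
  by rewrite divr_gt0 // ltr_wpDl ?rnorm_ge0.
exists N => n Nn; rewrite /eval_measure -bop_sumE -bop_oppE -bop_addE.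
apply: le_lt_trans (opnormP _ _) _; rewrite -bop_normE.
have n1 : 0 < rnorm x + 1 by rewrite ltr_wpDl ?rnorm_ge0.
have := NP n Nn; rewrite ltr_pdivlMr //; apply: le_lt_trans.
by rewrite ler_wpM2l ?rnorm_ge0 // lerDl.
Qed.

(** Coefficients of modulus 1 rotate the values of the functional onto the positive axis, so the sum
    of moduli becomes one value of it; functionals on [bop H H] then need no description. *)
Lemma semivariation_le (E : normedModType (C R)) (nu : set T -> E) S b : 0 <= b ->
  (forall n (A : 'I_n -> set T) (a : 'I_n -> C R), borel_partition A S ->
    (forall i, rnorm (a i) <= 1) -> rnorm (\sum_(i < n) a i *: nu (A i)) <= b) ->
  (semivariation nu S <= b%:E)%E.
Proof.
move=> b0 nub; apply: ge_ereal_sup => _ [->|[f /= f1 <-]]; first by rewrite lee_fin.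
apply: ge_ereal_sup => _ [n [A [AS ->]]]; rewrite lee_fin.
pose v i : C R := f (nu (A i)).
pose a i : C R := if v i == 0 then 1 else (v i)^* / `|v i|.
have a1 i : rnorm (a i) <= 1.
  rewrite /a; case: ifPn => [_|v0]; first by rewrite rnorm1.
  rewrite -ler_RtoC rnormE normrM normfV normr_id norm_conjC mulfV //.
  by rewrite normr_eq0.
have av i : RtoC (rnorm (v i)) = a i * v i.
  rewrite /a rnormE; case: eqVneq => [->|v0]; first by rewrite normr0 mulr0.
  rewrite mulrAC -normCKC expr2 mulfK //.
  by rewrite normr_eq0.
have -> : \sum_(i < n) rnorm (v i) = rnorm (f (\sum_(i < n) a i *: nu (A i))).
  have fE i : f (a i *: nu (A i)) = RtoC (rnorm (v i)) by rewrite av linearZ.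
  rewrite linear_sum (eq_bigr (fun i => RtoC (rnorm (v i))) (fun i _ => fE i)).
  by rewrite -RtoC_sum rnorm_RtoC ger0_norm // sumr_ge0 // => i _; exact: rnorm_ge0.
have fn : opnorm f = 1 by apply: RtoC_inj; rewrite -bop_normE rnormE f1.
by apply: le_trans (opnormP _ _) _; rewrite fn mul1r; exact: nub.
Qed.

Lemma sum_mu_le n (A : 'I_n -> set T) (a : 'I_n -> C R) S x : borel_partition A S ->
  (forall i, rnorm (a i) <= 1) -> rnorm (\sum_(i < n) a i *: mu (A i) x) <= out x S.
Proof.
move=> AS a1; apply: le_trans (outer_L_partition x AS); apply: le_trans (rnorm_sum _ _ _) _.
apply: ler_sum => i _; rewrite rnormZ; have [bA _ _] := AS.
by apply: le_trans (mu_le x (bA i)); rewrite ler_piMl ?rnorm_ge0.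
Qed.

Lemma mu_regular : (exists2 Q : set H, countable Q & dense Q) -> regular_measure mu.
Proof.
move=> sepH e B e0 bB; have e2 : 0 < e / 2 by lra.
have [K [P [cK oP KB BP KP]]] := uniform_regular dotE sepH bB e2.
exists K, P; split=> //.
apply: (@le_lt_trans _ _ (e / 2)%:E); last by rewrite lte_fin; lra.
apply: semivariation_le => [|n A a AS a1]; first lra.
rewrite bop_normE; apply: opnorm_le => x x1; rewrite bop_sumE.
under eq_bigr do rewrite bop_scaleE.
by apply: le_trans (sum_mu_le x AS a1) _; exact: KP.
Qed.

Lemma eval_bv_vector_measure x : bv_vector_measure (eval_measure mu x).
Proof.
split; last first.
  apply: (@le_lt_trans _ _ (L x setT)%:E); last exact: ltry.
  apply: ge_ereal_sup => _ [n [A [AS ->]]]; rewrite lee_fin.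
  apply: le_trans (outer_leT (L_additive x) setT).
  apply: le_trans (outer_L_partition x AS); apply: ler_sum => i _.
  by apply: mu_le; have [] := AS.
split=> [|e B e0 bB]; first exact: eval_vector_measure.
have e2 : 0 < e / 2 by lra.
have [K [P [cK oP KB BP KP]]] := regular_L x bB e2.
exists K, P; split=> //.
apply: (@le_lt_trans _ _ (e / 2)%:E); last by rewrite lte_fin; lra.
apply: semivariation_le => [|n A a AS a1]; first lra.
apply: le_trans (sum_mu_le x AS a1) _; apply/ltW; apply: le_lt_trans KP.
by apply: outer_le => //; exact: open_setD.
Qed.

Lemma simple_integral_le (l : int) (b : bop H H) s e : simple_fun s -> 0 <= e ->
  (forall x, Phi (phi l) x = b x) -> (forall t, rnorm (phi l t - s t) <= e) ->
  rnorm (b - simple_integral mu s) <= e * c.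
Proof.
move=> [fs bs] e0 Pb ps; rewrite bop_normE; apply: opnorm_le => x x1.
rewrite bop_addE bop_oppE -Pb /simple_integral fsbig_finite // bop_sumE rnorm_distrC.
under eq_bigr do rewrite bop_scaleE.
apply: le_trans (_ : e * (c * rnorm x) <= _); last first.
  by rewrite ler_wpM2l // ler_piMr.
apply: (@mu_lincomb _ _ id (fun a => s @^-1` [set a])) => //.
  exact: continuous_phi.
move=> t; rewrite rnorm_distrC; apply: le_trans (ps t); rewrite le_eqVlt; apply/orP; left.
apply/eqP; congr (rnorm (_ - _)).
have st : s t \in fset_set (range s) by rewrite in_fset_set //; apply: mem_set; exists t.
rewrite (bigD1_seq (s t)) //= ?fset_uniq // big1 => [|a ast].
  by rewrite addr0 /indicator mem_set // mulr1.
by rewrite /indicator ifF ?mulr0 //; apply/negP => /set_mem /= sta; rewrite sta eqxx in ast.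
Qed.

(** [vintegral] selects a value by choice, so both are needed: every admissible sequence of simple
    functions converges to b, and some such sequence exists. *)
Lemma mu_fourier (l : int) (b : bop H H) : (forall x, Phi (phi l) x = b x) ->
  fourier mu l = b.
Proof.
move=> Pb; have unique v : is_vintegral mu (phi l) v -> v = b.
  move=> [s [ss sl sv]]; apply: (cvgn_rnorm_unique sv).
  apply/cvgn_rnormP => e e0; pose d := e / (2 * (c + 1)).
  have d0 : 0 < d by rewrite divr_gt0 // mulr_gt0.
  have [N _ NP] := sl d d0; exists N => n Nn.
  apply: (@le_lt_trans _ _ (d * c)).
    by apply: (simple_integral_le (l := l)) => // [|t]; [exact: ltW|apply/ltW/NP].
  have : d * (2 * (c + 1)) = e by rewrite /d divfK // gt_eqF // mulr_gt0.
  by have := mulr_ge0 (ltW d0) c_ge0; lra.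
apply: unique; apply: (getPex (P := is_vintegral mu (phi l))).
exists b; have i0 n : 0 < (n.+1%:R : R)^-1 by rewrite invr_gt0 ltr0n.
have /choice[s sP] := fun n => simple_approximation (@continuous_phi R l) (i0 n).
exists s; split.
- by move=> n; have [] := sP n.
- move=> e e0; have [N NP] := small_inv e0; exists N => // n Nn t.
  by apply: lt_trans (NP n Nn); have [_] := sP n; apply.
apply/cvgn_rnormP => e e0; have [|N NP] := @small_inv R (e / (c + 1)); first by rewrite divr_gt0.
exists N => n Nn; have [ss sl] := sP n.
apply: (@le_lt_trans _ _ (n.+1%:R^-1 * c)).
  by apply: (simple_integral_le (l := l)) => // t; exact: ltW.
have := NP n Nn; rewrite ltr_pdivlMr //; have := i0 n; move: (n.+1%:R^-1) => a; nra.
Qed.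

Lemma mu_SOT_norm d : 0 <= d -> (forall x, L x setT <= d * rnorm x) ->
  (SOT_norm mu <= d%:E)%E.
Proof.
move=> d0 Ld; apply: ge_ereal_sup => _ [->|[x /= x1 <-]]; first by rewrite lee_fin.
have nx : rnorm x = 1 by apply: RtoC_inj; rewrite rnormE x1.
apply: ge_ereal_sup => _ [n [A [AS ->]]]; rewrite lee_fin.
rewrite -[d]mulr1 -nx; apply: le_trans (Ld x); apply: le_trans (outer_leT (L_additive x) setT).
apply: le_trans (outer_L_partition x AS); apply: ler_sum => i _.
by apply: mu_le; have [] := AS.
Qed.

End Representation.

End SetFunction.

Theorem theorem5p7 (R : realType) (H : completeNormedModType (C R))
    (dot : {dot H for Num.conj})
    (dotE : forall x : H, dot x x = `|x| ^+ 2)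
    (H_separable : exists2 D : set H, countable D & dense D)
    (A : op_matrix H)
    (A_toeplitz : toeplitz A)
    (A_multiplier : right_multiplier A) :
  exists mu : set (circle R) -> bop H H,
    [/\ M_SOT mu,
        forall k j : nat, A k j = fourier mu (j%:Z - k%:Z) &
        (SOT_norm mu <= right_multiplier_norm A)%E].
Proof.
have [c c0 Ac] := block_multiplier_exists A_toeplitz A_multiplier.
have /choice[w hw] : forall n, exists z : C R, (n.+1.*2).-primitive_root z.
  by move=> n; apply: prim_root_exists.
have [U [UU Uoo]] := ultraFilterLemma (F := \oo) _.
pose Phi := limit_int A hw; pose L := limit_var A hw U.
have PhiD (f g : circle R -> C R) x : continuous f -> continuous g ->
    Phi (fun t => f t + g t) x = Phi f x + Phi g x.
  move=> fc gc; exact: (limit_intD dotE A_toeplitz c0 Ac hw x fc gc (continuous_add fc gc)).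
have PhiZ a (f : circle R -> C R) x : continuous f ->
    Phi (fun t => a * f t) x = a *: Phi f x.
  move=> fc.
  exact: (limit_intZ dotE A_toeplitz c0 Ac hw x fc (@continuous_scale R a f fc)).
have Phi_linear (f : circle R -> C R) a x y : continuous f ->
    Phi f (a *: x + y) = a *: Phi f x + Phi f y.
  move=> fc; exact: (limit_int_linear dotE A_toeplitz c0 Ac hw a x y fc).
have L_additive x : finitely_additive (L x) := limit_var_content dotE c0 Ac hw UU x.
have LT d x : 0 <= d -> block_multiplier A d -> L x setT <= d * rnorm x.
  move=> d0 Ad; exact: (limit_varT dotE c0 Ac hw UU x d0 Ad).
have L_scale a x S : L (a *: x) S = rnorm a * L x S :=
  limit_var_scale dotE c0 Ac hw UU a x S.
have L_add x y S : L (x + y) S <= L x S + L y S :=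
  limit_var_add dotE c0 Ac hw UU x y S.
have Phi_le (f : circle R -> C R) x M e G : continuous f -> 0 <= M -> 0 <= e -> open G ->
    (forall t, rnorm (f t) <= M) -> (forall t, ~ G t -> rnorm (f t) <= e) ->
    rnorm (Phi f x) <= M * inner_content (L x) G + e * (c * rnorm x).
  exact: (limit_int_le dotE A_toeplitz c0 Ac hw UU Uoo x).
have LTc x := LT c x c0 Ac.
have /choice[mu muP] := operator_exists PhiD PhiZ Phi_linear L_additive LTc Phi_le.
have mu_approx B x f e : borel B -> approximates L f B x e ->
    rnorm (Phi f x - mu B x) <= 2 * e.
  by move=> bB; exact: muP.
exists mu; split.
- split; last by move=> x; apply: (eval_bv_vector_measure (Phi := Phi) (L := L) (c := c)).
  split; first exact: (norm_vector_measure (Phi := Phi) (L := L) (c := c)).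
  exact: (mu_regular (Phi := Phi) (L := L) (c := c)).
- move=> k j; apply/esym; apply: (mu_fourier (Phi := Phi) (L := L) (c := c)) => // x.
  exact: (limit_int_phi dotE A_toeplitz c0 Ac hw x (@continuous_phi R _)).
(* This d is unrelated to c: through [block_multiplier_norm] it bounds [L x setT] for the mu already
   built. *)
apply: le_ereal_inf_tmp => _ [d [d0 Ad] <-].
apply: (mu_SOT_norm (Phi := Phi) (L := L) (c := c)) => // x.
by apply: LT => //; exact: block_multiplier_norm.
Qed.
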